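(* Let $F\subset\mathbb{R}^2$ be a compact convex body. Let $\mathcal{K}^2$ denote the family of nonempty compact convex subsets of $\mathbb{R}^2$, let $s(K)$ denote the Steiner point of $K$, and define $\mathscr{H}_0:=\{h_K: K\in\mathcal{K}^2,\ s(K)=0\}$. For $h\in\mathscr{H}_0$ and $Q\in O(2)$ define the optimized inclusion residual $$\Psi_F(h,Q):=\min_{a\in\mathbb{R}^2}\max_{u\in\mathbb{S}^1}\{a\cdot u+h(Q^{T}u)-h_F(u)\}.$$ Then the minimum over $a$ in this definition is attained. Moreover, the curve formulation $$D(F)=\min\Big\{\max_{s,t\in[0,1]}\|\gamma(s)-\gamma(t)\| : \gamma\in C([0,1];\mathbb{R}^2),\ \gamma(0)=\gamma(1)=0,\ \min_{t\in[0,1]}\operatorname{dist}(\gamma(t),Q^{T}(\partial F-x))=0\ \forall(x,Q)\in F\times O(2)\Big\}\quad(\mathrm{A})$$ is equivalent to each of the following optimization problems, whose minima are attained: $$D(F)=\min\big\{\operatorname{diam}K : K\in\mathcal{K}^2,\ a+QK\not\subset\operatorname{int}F\ \ \forall a\in\mathbb{R}^2,\ \forall Q\in O(2)\big\}\quad(\mathrm{B})$$ and $$D(F)=\min\Big\{\max_{u\in\mathbb{S}^1}\big(h(u)+h(-u)\big) : h\in\mathscr{H}_0,\ \Psi_F(h,Q)\ge 0\ \ \forall Q\in O(2)\Big\}.\quad(\mathrm{C})$$ Convexification preserves both feasibility and diameter (if $\gamma$ with trace $\Gamma$ is feasible in (A), then $\operatorname{conv}\Gamma$ is feasible in (B) and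 $\operatorname{diam}\operatorname{conv}\Gamma=\operatorname{diam}\Gamma$); translation to Steiner-point normalization, $K\mapsto K-s(K)$, preserves feasibility and the objective in (B); and an optimal convex set $K$ in (B) generates an optimal closed escape path (a closed diameter-escape path for $F$ of diameter $D(F)$) by traversing $\partial K$, with a segment traversed from one endpoint to the other and back in the one-dimensional case.
   Context: $O(2)$ is the full orthogonal group of $\mathbb{R}^2$, $\mathbb{S}^1$ the unit circle, $\|\cdot\|$ the Euclidean norm. A compact convex body is a compact convex set with nonempty interior. The support function of a nonempty compact convex set $K$ is $h_K(u)=\max_{x\in K}x\cdot u$. The Steiner point is $s(K)=\frac1\pi\int_{\mathbb{S}^1}h_K(u)\,u\,du$. A closed path is a continuous map $\gamma:[0,1]\to\mathbb{R}^2$ with $\gamma(0)=\gamma(1)$; its trace is $\Gamma=\gamma([0,1])$ and $\operatorname{diam}\gamma:=\operatorname{diam}\Gamma$. A closed path $\gamma$ is a diameter-escape path for $F$ if $a+Q\Gamma\not\subset\operatorname{int}F$ for every $a\in\mathbb{R}^2$ and $Q\in O(2)$. The critical escape diameter is $D(F):=\inf\{\operatorname{diam}\gamma:\gamma\text{ is a closed diameter-escape path for }F\}$. *)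

(* Defs.v *)
From HB Require Import structures.
From mathcomp Require Import all_boot all_order all_algebra.
From mathcomp Require Import all_classical all_reals all_analysis.
Set Implicit Arguments.
Unset Strict Implicit.
Unset Printing Implicit Defensive.
Import Order.TTheory GRing.Theory Num.Theory.
Import numFieldNormedType.Exports.
Local Open Scope classical_set_scope.
Local Open Scope ring_scope.

(* Built on MathComp-Analysis.
   Points of the plane are row vectors ['rV[R]_2]; the library's norm [`|x|] on
   them is the sup norm, which gives the usual topology, but all metric notions
   below use the Euclidean norm [enorm]. *)

(* A real maximum or minimum that occurs inside a definition is written [sup]
   or [inf]; for the sets in question these are extrema of continuous functions
   on nonempty compact sets, except for the minimum over [a] in [Psi], whose
   attainment is part of the theorem. *)
Definition is_min (R : realType) (A : set R) (m : R) : Prop :=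
  A m /\ lbound A m.

Section Plane.
Variable R : realType.
Local Notation plane := ('rV[R]_2).

Definition dot (x y : plane) : R := \sum_(i < 2) x ord0 i * y ord0 i.

Definition enorm (x : plane) : R := Num.sqrt (dot x x).

Definition S1 : set plane := [set u | enorm u = 1].

Definition O2 : set 'M[R]_2 := [set Q | Q *m Q^T = 1%:M].

(* The vector Qx: vectors being rows, it is the transpose of Q *m x^T. *)
Definition mxact (Q : 'M[R]_2) (x : plane) : plane := x *m Q^T.

Definition diam (A : set plane) : R :=
  sup [set enorm (x - y) | x in A & y in A].

Definition dist (x : plane) (A : set plane) : R :=
  inf [set enorm (x - y) | y in A].

Definition boundary (A : set plane) : set plane := closure A `\` A°.

Definition convex_hull (A : set plane) : set plane :=
  smallest (@convex_set R plane) A.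

Definition segment (p q : plane) : set plane :=
  [set p + t *: (q - p) | t in `[0, 1]%classic].

Definition K2 : set (set plane) :=
  [set K | [/\ K !=set0, compact K & @convex_set R plane K]].

Definition convex_body (F : set plane) : Prop :=
  [/\ compact F, @convex_set R plane F & F° !=set0].

Definition support_fun (K : set plane) (u : plane) : R :=
  sup [set dot x u | x in K].

Definition circle_point (theta : R) : plane :=
  \row_(j < 2) (if j == ord0 then cos theta else sin theta).

(* Arc-length integral over the circle, through the angle. *)
Definition steiner (K : set plane) : plane :=
  \row_(j < 2) (pi^-1 *
    \int[lebesgue_measure]_(theta in `[0, 2 * pi])
      (support_fun K (circle_point theta) * circle_point theta ord0 j)).

(* Only the values of a path on [0, 1] matter. *)
Definition closed_path (g : R -> plane) : Prop :=
  {within `[0, 1], continuous g} /\ g 0 = g 1.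

Definition trace (g : R -> plane) : set plane := g @` `[0, 1]%classic.

(* No congruent copy of A lies in the interior of F. *)
Definition unfit (F A : set plane) : Prop :=
  forall (a : plane) (Q : 'M[R]_2), O2 Q ->
    ~ [set a + mxact Q x | x in A] `<=` F°.

Definition escape_path (F : set plane) (g : R -> plane) : Prop :=
  closed_path g /\ unfit F (trace g).

Definition critical_diam (F : set plane) : R :=
  inf [set diam (trace g) | g in escape_path F].

(* The elements of H0 are defined on the whole plane; they are determined by
   their restrictions to the circle by homogeneity. *)
Definition H0 : set (plane -> R) :=
  [set support_fun K | K in [set K | K2 K /\ steiner K = 0]].

Definition excess (F : set plane) (h : plane -> R) (Q : 'M[R]_2) (a : plane)
    : R :=
  sup [set dot a u + h (mxact Q^T u) - support_fun F u | u in S1].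

Definition Psi (F : set plane) (h : plane -> R) (Q : 'M[R]_2) : R :=
  inf (range (excess F h Q)).

Definition feasibleA (F : set plane) (g : R -> plane) : Prop :=
  [/\ {within `[0, 1], continuous g}, g 0 = 0, g 1 = 0 &
    forall (x : plane) (Q : 'M[R]_2), F x -> O2 Q ->
      is_min [set dist (g t) [set mxact Q^T (y - x) | y in boundary F]
             | t in `[0, 1]%classic] 0].

Definition objectiveA (g : R -> plane) : R :=
  sup [set enorm (g s - g t) | s in `[0, 1]%classic & t in `[0, 1]%classic].

Definition feasibleB (F K : set plane) : Prop := K2 K /\ unfit F K.

Definition feasibleC (F : set plane) (h : plane -> R) : Prop :=
  H0 h /\ forall Q : 'M[R]_2, O2 Q -> 0 <= Psi F h Q.

Definition objectiveC (h : plane -> R) : R :=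
  sup [set h u + h (- u) | u in S1].

(* g runs once around the boundary of K; a nondegenerate segment is run from
   one endpoint to the other and back. *)
Definition boundary_traversal (K : set plane) (g : R -> plane) : Prop :=
  (K° !=set0 /\
   [/\ closed_path g, {in `[0, 1[ &, injective g} & trace g = boundary K]) \/
  (exists p q : plane, [/\ p <> q, K = segment p q &
     forall t, t \in `[0, 1] -> g t = p + (1 - `|2 * t - 1|) *: (q - p)]).

End Plane.

(* Main.v *)
Require Import Defs.
From mathcomp Require Import all_boot all_order all_algebra.
From mathcomp Require Import all_classical all_reals all_analysis.
From mathcomp Require Import ring lra.
Import Order.TTheory GRing.Theory Num.Theory.
Import numFieldNormedType.Exports.
Local Open Scope classical_set_scope.
Local Open Scope ring_scope.
Set Implicit Arguments.
Unset Strict Implicit.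
Unset Printing Implicit Defensive.

(** Problems (A), (B) and (C) are three encodings of one compactness problem; the
    whole proof turns around (B), where a set is feasible when no congruent copy
    of it fits into the interior of [F].

    Existence of a minimum in (B). Feasibility and diameter are invariant under
    translation, so a minimizing sequence may be taken inside a fixed ball. A
    limit along an ultrafilter is then a compact convex set with diameter at most
    the infimum ([blaschke]). Being unfit survives the limit ([exists_minB]): if
    a copy of the limit lay in the interior of [F], it would do so with a
    positive margin, and a member of the family within that margin would fit too.

    From paths to convex sets. The hull of a trace is compact, because by
    Caratheodory's theorem it is obtained from the trace by finitely many joins
    ([caratheodory], [compact_hull]); it has the same diameter because Euclidean
    balls are convex ([diam_convex_hull]); and it is unfit because it contains
    the trace.

    From convex sets to paths. A feasible set with interior points has a boundary
    curve, drawn in polar coordinates around an interior point with the help of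
    the gauge of the set ([boundary_path]); a feasible set without interior
    points is a nondegenerate segment ([thin_segment]), run there and back. As
    the set is the hull of the curve and the interior of [F] is convex, neither
    diameter nor unfitness is lost ([feasibleB_traversal]). These two passages
    identify the minimum in (B) with the infimum over escape paths
    ([critical_diamP]).

    Problem (A) is the same as the problem for escape paths starting at the
    origin: a copy of the path that starts in [F] stays in the interior unless it
    meets the boundary, because its trace is connected ([crossing]).

    Problem (C) is (B) read through support functions. By separation, a copy of
    [K] lies in the interior of [F] exactly when its support function is below
    that of [F] by a margin, that is, when the excess is negative
    ([excess_lt0P]); the excess being continuous and coercive in the translation,
    its minimum is attained ([Psi_attained]). The objective is the maximal width,
    which is the diameter ([objectiveC_support]). The normalization at the
    Steiner point costs nothing, because the Steiner point moves along with
    translations ([steiner_translate]), which is the computation of the second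
    moments of the circle ([circle_moment]). *)

(** * Euclidean geometry of the plane *)

Section Euclid.
Variable R : realType.
Local Notation plane := ('rV[R]_2).
Implicit Types (x y z u : plane) (A K : set plane).

Lemma dotE x y : dot x y = x ord0 ord0 * y ord0 ord0 + x ord0 ord_max * y ord0 ord_max.
Proof.
rewrite /dot big_ord_recl big_ord_recl big_ord0 addr0.
by congr (_ + x ord0 _ * y ord0 _); apply: val_inj.
Qed.

Lemma plane_eqP x y : x ord0 ord0 = y ord0 ord0 ->
  x ord0 ord_max = y ord0 ord_max -> x = y.
Proof.
move=> e0 e1; apply/rowP => i.
have [->//|->//] : i = ord0 \/ i = ord_max.
by case: i => [[|[|//]] h]; [left|right]; apply: val_inj.
Qed.

Lemma dotC x y : dot x y = dot y x.
Proof. by rewrite !dotE; ring. Qed.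
Lemma dotDl x y z : dot (x + y) z = dot x z + dot y z.
Proof. by rewrite !dotE !mxE; ring. Qed.
Lemma dotNl x z : dot (- x) z = - dot x z.
Proof. by rewrite !dotE !mxE; ring. Qed.
Lemma dotBl x y z : dot (x - y) z = dot x z - dot y z.
Proof. by rewrite dotDl dotNl. Qed.
Lemma dotZl a x z : dot (a *: x) z = a * dot x z.
Proof. by rewrite !dotE !mxE; ring. Qed.
Lemma dotDr x y z : dot z (x + y) = dot z x + dot z y.
Proof. by rewrite !dotE !mxE; ring. Qed.
Lemma dotNr x z : dot z (- x) = - dot z x.
Proof. by rewrite !dotE !mxE; ring. Qed.
Lemma dotBr x y z : dot z (x - y) = dot z x - dot z y.
Proof. by rewrite dotDr dotNr. Qed.
Lemma dotZr a x z : dot z (a *: x) = a * dot z x.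
Proof. by rewrite !dotE !mxE; ring. Qed.
Lemma dot0l z : dot 0 z = 0.
Proof. by rewrite !dotE !mxE; ring. Qed.

Lemma dot_ge0 x : 0 <= dot x x.
Proof. by rewrite dotE addr_ge0// -expr2 sqr_ge0. Qed.

Lemma enorm_ge0 x : 0 <= enorm x.
Proof. exact: sqrtr_ge0. Qed.

Lemma sqr_enorm x : enorm x ^+ 2 = dot x x.
Proof. by rewrite sqr_sqrtr// dot_ge0. Qed.

Lemma enorm_le x (c : R) : 0 <= c -> dot x x <= c ^+ 2 -> enorm x <= c.
Proof.
by move=> c0 h; rewrite -(@ler_pXn2r _ 2) ?nnegrE ?enorm_ge0// sqr_enorm.
Qed.

Lemma enorm_eq0 x : enorm x = 0 -> x = 0.
Proof.
move=> h; have := sqr_enorm x; rewrite h dotE expr0n /= => /esym/eqP.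
rewrite -!expr2 paddr_eq0 ?sqr_ge0// !sqrf_eq0 => /andP[/eqP e0 /eqP e1].
by apply: plane_eqP; rewrite mxE.
Qed.

Lemma enorm0 : enorm (0 : plane) = 0.
Proof. by rewrite /enorm dot0l sqrtr0. Qed.

Lemma enorm_gt0 x : x != 0 -> 0 < enorm x.
Proof.
move=> /eqP x0; rewrite lt_neqAle enorm_ge0 andbT eq_sym.
by apply/eqP => /enorm_eq0.
Qed.

Lemma enormZ (a : R) x : enorm (a *: x) = `|a| * enorm x.
Proof. by rewrite /enorm dotZl dotZr mulrA -expr2 sqrtrM ?sqr_ge0// sqrtr_sqr. Qed.

Lemma enormN x : enorm (- x) = enorm x.
Proof. by rewrite /enorm dotNl dotNr opprK. Qed.

Lemma enormC x y : enorm (x - y) = enorm (y - x).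
Proof. by rewrite -enormN opprB. Qed.

(** Cauchy-Schwarz, from Lagrange's identity in two dimensions. *)
Lemma dot_le_enorm x y : dot x y <= enorm x * enorm y.
Proof.
apply: le_trans (ler_norm _) _.
rewrite -(@ler_pXn2r _ 2) ?nnegrE ?mulr_ge0 ?enorm_ge0//.
rewrite exprMn !sqr_enorm real_normK ?num_real// !dotE.
set a := x _ _; set b := x _ _; set c := y _ _; set d := y _ _.
rewrite -subr_ge0; have -> : (a * a + b * b) * (c * c + d * d) -
  (a * c + b * d) ^+ 2 = (a * d - b * c) ^+ 2 by ring.
exact: sqr_ge0.
Qed.

Lemma dot_S1_le u x : S1 u -> dot x u <= enorm x.
Proof. by move=> Su; rewrite -[leRHS]mulr1 -[X in _ * X]Su dot_le_enorm. Qed.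

Lemma enormD x y : enorm (x + y) <= enorm x + enorm y.
Proof.
apply: enorm_le; first by rewrite addr_ge0 ?enorm_ge0.
rewrite !(dotDl, dotDr) sqrrD !sqr_enorm (dotC y x).
have := dot_le_enorm x y; lra.
Qed.

Lemma enorm_triangle y x z : enorm (x - z) <= enorm (x - y) + enorm (y - z).
Proof.
have -> : x - z = (x - y) + (y - z) by rewrite addrA subrK.
exact: enormD.
Qed.

Lemma enormB_le x y : enorm x - enorm y <= enorm (x - y).
Proof. by rewrite lerBlDr -{1}(subrK y x) enormD. Qed.

Lemma enorm_coord_le x j : `|x ord0 j| <= enorm x.
Proof.
rewrite -(@ler_pXn2r _ 2) ?nnegrE ?enorm_ge0// sqr_enorm real_normK ?num_real//.
rewrite dotE -!expr2.
have [->|->] : j = ord0 \/ j = ord_max.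
  by case: j => [[|[|//]] h]; [left|right]; apply: val_inj.
  by rewrite lerDl sqr_ge0.
by rewrite lerDr sqr_ge0.
Qed.

Lemma enorm_le_coord x (e : R) : (forall j, `|x ord0 j| <= e) -> enorm x <= 2 * e.
Proof.
move=> h; have e0 : 0 <= e := le_trans (normr_ge0 _) (h ord0).
apply: enorm_le; first by rewrite mulr_ge0.
rewrite dotE; have := h ord0; have := h ord_max.
rewrite -!(@ler_pXn2r _ 2 _ `|_|) ?nnegrE// !real_normK ?num_real//.
have : 0 <= e ^+ 2 by rewrite sqr_ge0.
rewrite exprMn -!expr2; lra.
Qed.

Lemma S1_unit x : x != 0 -> S1 ((enorm x)^-1 *: x).
Proof.
move=> x0; have n0 := enorm_gt0 x0.
by rewrite /S1 /= enormZ ger0_norm ?invr_ge0 ?enorm_ge0// mulVf// gt_eqF.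
Qed.

Lemma S1_nonempty : S1 (R := R) !=set0.
Proof.
exists (\row_j (j == ord0)%:R); rewrite /S1 /= /enorm dotE !mxE /=.
by rewrite mulr1 mulr0 addr0 sqrtr1.
Qed.

(** ** Topology in terms of the Euclidean norm *)

Lemma nbhs_enormP x A :
  nbhs x A <-> exists2 e : R, 0 < e & forall y, enorm (y - x) < e -> A y.
Proof.
split=> [/nbhs_ballP[e /= e0 h]|[e e0 h]].
  exists e => // y yx; apply: h; split=> // i j.
  rewrite (ord1 i) -ball_normE /=; apply: le_lt_trans yx.
  by rewrite enormC; apply: le_trans (enorm_coord_le _ j); rewrite !mxE.
apply/nbhs_ballP; exists (e / 3) => /=; first by rewrite divr_gt0.
move=> y [_ yx]; apply: h; rewrite enormC.
apply: (@le_lt_trans _ _ (2 * (e / 3))); last by lra.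
apply: enorm_le_coord => j; have := yx ord0 j.
by rewrite -ball_normE /= !mxE => /ltW.
Qed.

Lemma interior_enormP x A :
  A° x <-> exists2 e : R, 0 < e & forall y, enorm (y - x) < e -> A y.
Proof. exact: nbhs_enormP. Qed.

Lemma closure_enormP x A :
  closure A x <-> forall e : R, 0 < e -> exists2 y, A y & enorm (y - x) < e.
Proof.
split=> [h e e0|h B /nbhs_enormP[e e0 eB]].
  have [|y [Ay /= ye]] := h [set y | enorm (y - x) < e].
    by apply/nbhs_enormP; exists e.
  by exists y.
by have [y Ay ye] := h e e0; exists y; split => //; apply: eB.
Qed.

Lemma lipschitz_continuous (f : plane -> R) (c : R) :
  (forall x y, f x - f y <= c * enorm (x - y)) -> continuous f.
Proof.
move=> fL x; apply: (iffRL (@cvgrPdist_lt _ _ _ (nbhs x) _ f (f x))) => e e0.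
near=> y.
have c1 : 0 < `|c| + 1 by rewrite ltr_pwDr.
have yx : enorm (y - x) < e / (`|c| + 1).
  near: y; apply/nbhs_enormP; exists (e / (`|c| + 1)) => //.
  by rewrite divr_gt0.
rewrite ltr_pdivlMr// in yx.
have cle : c * enorm (y - x) <= enorm (y - x) * (`|c| + 1).
  rewrite mulrC ler_wpM2l ?enorm_ge0//.
  by apply: le_trans (ler_norm _) _; rewrite lerDl.
have h1 := fL x y; have h2 := fL y x; rewrite enormC in h1.
by rewrite ltr_norml; apply/andP; split; lra.
Unshelve. all: by end_near. Qed.

Lemma enorm_continuous : continuous (@enorm R).
Proof. by apply: (@lipschitz_continuous _ 1) => x y; rewrite mul1r enormB_le. Qed.

Lemma dot_continuous u : continuous (fun x => dot x u).
Proof.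
apply: (@lipschitz_continuous _ (enorm u)) => x y.
by rewrite -dotBl mulrC dot_le_enorm.
Qed.

Lemma plane_hausdorff : hausdorff_space plane.
Proof. exact: norm_hausdorff. Qed.

Lemma compactK_closed K : compact K -> closed K.
Proof. exact: compact_closed plane_hausdorff. Qed.

Lemma compact_enormP K :
  compact K <-> closed K /\ exists c : R, forall x, K x -> enorm x <= c.
Proof.
split=> [cK|[clK [c cB]]].
  split; first exact: compactK_closed.
  have [->|/set0P K0] := eqVneq K set0; first by exists 0.
  have [x _ xm] := compact_EVT_max K0 cK
    (continuous_subspaceT enorm_continuous).
  by exists (enorm x) => y Ky; apply: xm; rewrite inE.
apply: bounded_closed_compact => //.
exists c; split; first exact: num_real.
move=> d cd x Kx; change (mx_norm x <= d); rewrite mx_normrE.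
apply/bigmax_leP; split=> [|[i j] _ /=].
  by apply: le_trans (ltW cd); apply: le_trans (cB _ Kx); exact: enorm_ge0.
rewrite (ord1 i); apply: le_trans (enorm_coord_le _ _) _.
by apply: le_trans (cB _ Kx) (ltW cd).
Qed.

Lemma closed_le_fun (f : plane -> R) (c : R) :
  continuous f -> closed [set x | f x <= c].
Proof.
move=> cf; apply: (@closed_comp _ _ f [set t | t <= c]).
  by move=> x _; apply: cf.
exact: closed_le.
Qed.

Lemma closed_eq_fun (f : plane -> R) (c : R) :
  continuous f -> closed [set x | f x = c].
Proof.
move=> cf; apply: (@closed_comp _ _ f [set t | t = c]).
  by move=> x _; apply: cf.
exact: closed_eq.
Qed.

Lemma compact_S1 : compact (S1 (R := R)).
Proof.
apply/compact_enormP; split; first exact: closed_eq_fun enorm_continuous.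
by exists 1 => x ->.
Qed.

Lemma compact_enorm_ball (c : R) : compact [set x : plane | enorm x <= c].
Proof.
apply/compact_enormP; split; first exact: closed_le_fun enorm_continuous.
by exists c => x.
Qed.

End Euclid.

(** * Convex sets *)

Lemma convexP (R : realType) (V : lmodType R) (A : set V) : @convex_set R V A <->
  forall x y (t : R), A x -> A y -> 0 <= t -> t <= 1 -> A (t *: x + (1 - t) *: y).
Proof.
split=> [cA x y t Ax Ay t0 t1|cA x y l].
  have := cA x y (Itv01 t0 t1); rewrite !inE => /(_ Ax Ay).
  exact.
by rewrite !inE => Ax Ay; apply: cA.
Qed.

(** * Orthogonal matrices *)

Section Orthogonal.
Variable R : realType.
Local Notation plane := ('rV[R]_2).
Implicit Types (x y z u : plane) (Q : 'M[R]_2).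

Lemma O2_tr Q : O2 Q -> O2 Q^T.
Proof. by rewrite /O2 /= trmxK => h; exact: mulmx1C. Qed.

Lemma mxactD Q x y : mxact Q (x + y) = mxact Q x + mxact Q y.
Proof. exact: mulmxDl. Qed.

Lemma mxactB Q x y : mxact Q (x - y) = mxact Q x - mxact Q y.
Proof. exact: mulmxBl. Qed.

Lemma mxactZ Q a x : mxact Q (a *: x) = a *: mxact Q x.
Proof. by rewrite /mxact -scalemxAl. Qed.

Lemma mxactK Q : O2 Q -> cancel (mxact Q) (mxact Q^T).
Proof. by move=> /O2_tr h x; rewrite /mxact -mulmxA h mulmx1. Qed.

Lemma mxactKV Q : O2 Q -> cancel (mxact Q^T) (mxact Q).
Proof. by move=> h x; rewrite /mxact trmxK -mulmxA h mulmx1. Qed.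

Lemma dot_mulmx x y : dot x y = (x *m y^T) ord0 ord0.
Proof. by rewrite mxE; apply: eq_bigr => i _; rewrite mxE. Qed.

Lemma dot_mxact Q x u : dot (mxact Q x) u = dot x (mxact Q^T u).
Proof. by rewrite !dot_mulmx /mxact !trmx_mul !trmxK mulmxA. Qed.

Lemma enorm_mxact Q x : O2 Q -> enorm (mxact Q x) = enorm x.
Proof. by move=> h; rewrite /enorm dot_mxact mxactK. Qed.

Lemma S1_mxact Q u : O2 Q -> S1 u -> S1 (mxact Q u).
Proof. by move=> h; rewrite /S1 /= enorm_mxact. Qed.

Lemma O2_id : O2 (1%:M : 'M[R]_2).
Proof. by rewrite /O2 /= trmx1 mulmx1. Qed.

Lemma mxact_id x : mxact 1%:M x = x.
Proof. by rewrite /mxact trmx1 mulmx1. Qed.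

End Orthogonal.

(** * Diameters and support functions *)

Section Support.
Variable R : realType.
Local Notation plane := ('rV[R]_2).
Implicit Types (x y z u a : plane) (A K F : set plane) (Q : 'M[R]_2).

Lemma diam_ub A (c : R) x y : (forall z, A z -> enorm z <= c) ->
  A x -> A y -> enorm (x - y) <= diam A.
Proof.
move=> cA Ax Ay; apply: ub_le_sup; last by exists x => //; exists y.
exists (c + c) => _ [p Ap [q Aq <-]].
apply: le_trans (enormD _ _) _; rewrite enormN.
by rewrite lerD// cA.
Qed.

Lemma diam_ge A x y : compact A -> A x -> A y -> enorm (x - y) <= diam A.
Proof. by move=> /compact_enormP[_ [c cA]]; exact: diam_ub cA. Qed.

Lemma diam_le A (c : R) : A !=set0 ->
  (forall x y, A x -> A y -> enorm (x - y) <= c) -> diam A <= c.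
Proof.
move=> [x Ax] h; apply: ge_sup; first by exists (enorm (x - x)), x => //; exists x.
by move=> _ [p Ap [q Aq <-]]; apply: h.
Qed.

Lemma support_ge K x u : compact K -> K x -> dot x u <= support_fun K u.
Proof.
move=> /compact_enormP[_ [c cK]] Kx; apply: ub_le_sup; last by exists x.
exists (c * enorm u) => _ [y Ky <-].
by apply: le_trans (dot_le_enorm _ _) _; rewrite ler_wpM2r ?enorm_ge0 ?cK.
Qed.

Lemma support_le K u (c : R) : K !=set0 -> (forall x, K x -> dot x u <= c) ->
  support_fun K u <= c.
Proof.
move=> [x Kx] h; apply: ge_sup; first by exists (dot x u), x.
by move=> _ [y Ky <-]; apply: h.
Qed.

Lemma support_attained K u : compact K -> K !=set0 ->
  exists2 x, K x & support_fun K u = dot x u.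
Proof.
move=> cK K0.
have [x /[!inE] Kx xm] := compact_EVT_max K0 cK
  (continuous_subspaceT (@dot_continuous R u)).
exists x => //; apply/eqP; rewrite eq_le support_ge// andbT.
by apply: support_le => // y Ky; apply: xm; rewrite inE.
Qed.

Lemma support_lipschitz K (c : R) u v : compact K -> K !=set0 ->
  (forall x, K x -> enorm x <= c) ->
  support_fun K u - support_fun K v <= c * enorm (u - v).
Proof.
move=> cK K0 cB; have [x Kx ->] := support_attained u cK K0.
have := support_ge v cK Kx.
have : dot x (u - v) <= c * enorm (u - v).
  by apply: le_trans (dot_le_enorm _ _) _; rewrite ler_wpM2r ?enorm_ge0 ?cB.
rewrite dotBr; lra.
Qed.

Lemma support_continuous K : compact K -> K !=set0 ->
  continuous (support_fun K).
Proof.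
move=> cK K0; have /compact_enormP[_ [c cB]] := cK.
by apply: (@lipschitz_continuous _ _ c) => x y; exact: support_lipschitz.
Qed.

Lemma support_abs K (c : R) u : compact K -> K !=set0 ->
  (forall x, K x -> enorm x <= c) -> S1 u -> `|support_fun K u| <= c.
Proof.
move=> cK K0 cB Su; have [x Kx ->] := support_attained u cK K0.
have h1 := dot_S1_le x Su; have h2 := dot_S1_le (- x) Su.
rewrite dotNl enormN in h2; have h3 := cB _ Kx.
by rewrite ler_norml; apply/andP; split; lra.
Qed.

Lemma support_translate K a u : compact K -> K !=set0 ->
  support_fun [set x + a | x in K] u = support_fun K u + dot a u.
Proof.
move=> cK K0; apply/eqP; rewrite eq_le; apply/andP; split.
  apply: support_le; first by case: K0 => x Kx; exists (x + a), x.
  by move=> _ [x Kx <-]; rewrite dotDl lerD2r support_ge.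
have [x Kx ->] := support_attained u cK K0; rewrite -dotDl.
have /compact_enormP[_ [c cB]] := cK.
apply: ub_le_sup; last by exists (x + a) => //; exists x.
exists ((c + enorm a) * enorm u) => _ [_ [y Ky <-] <-].
apply: le_trans (dot_le_enorm _ _) _; rewrite ler_wpM2r ?enorm_ge0//.
by apply: le_trans (enormD _ _) _; rewrite lerD2r cB.
Qed.

(** A point outside a compact convex set is strictly separated from it by the
    direction pointing to it from its nearest point [z]: a point [x] of the set
    with [dot (x - z) (y - z) > 0] would allow moving from [z] towards [x] and
    getting closer to [y]. *)
Lemma separation F y : F !=set0 -> compact F -> @convex_set R plane F -> ~ F y ->
  exists2 u, S1 u & support_fun F u < dot y u.
Proof.
move=> F0 cF /convexP vF nFy.
have cd : continuous (fun x => enorm (x - y)).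
  apply: (@lipschitz_continuous _ _ 1) => p q; rewrite mul1r.
  by have := enormB_le (p - y) (q - y); rewrite opprB addrA subrK.
have [z /[!inE] Fz zm] := compact_EVT_min F0 cF (continuous_subspaceT cd).
have yz : y - z != 0 by apply/eqP => /subr0_eq e; apply: nFy; rewrite e.
have acute x : F x -> dot (x - z) (y - z) <= 0.
  move=> Fx; rewrite leNgt; apply/negP => d0.
  set d := dot _ _ in d0; set n := dot (x - z) (x - z).
  have n0 : 0 <= n by exact: dot_ge0.
  have nd : 0 < n + d by rewrite ltr_wpDl.
  (* any [t] in ]0, 1] with [t * n < 2 * d] brings [z] closer to [y] *)
  set t := d / (n + d).
  have t0 : 0 < t by rewrite divr_gt0.
  have t1 : t <= 1 by rewrite ler_pdivrMr// mul1r lerDr.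
  have := zm (t *: x + (1 - t) *: z); rewrite inE.
  move=> /(_ (vF _ _ _ Fx Fz (ltW t0) t1)).
  rewrite -(@ler_pXn2r _ 2) ?nnegrE ?enorm_ge0// !sqr_enorm.
  have -> : t *: x + (1 - t) *: z - y = t *: (x - z) - (y - z).
    by apply: plane_eqP; rewrite !mxE; ring.
  have -> : dot (z - y) (z - y) = dot (y - z) (y - z).
    by rewrite -opprB dotNl dotNr opprK.
  have -> : dot (t *: (x - z) - (y - z)) (t *: (x - z) - (y - z)) =
      t * (t * n) - 2 * (t * d) + dot (y - z) (y - z).
    by rewrite /n /d !dotE !mxE; ring.
  have tnd : t * (n + d) = d by rewrite /t mulfVK// gt_eqF.
  have : t * (t * n) <= t * d.
    rewrite ler_pM2l// -[leRHS]tnd mulrDr lerDl.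
    by rewrite mulr_ge0// ltW.
  have : 0 < t * d by rewrite mulr_gt0.
  lra.
exists ((enorm (y - z))^-1 *: (y - z)); first exact: S1_unit.
have i0 : 0 < (enorm (y - z))^-1 by rewrite invr_gt0 enorm_gt0.
apply: (@le_lt_trans _ _ (dot z ((enorm (y - z))^-1 *: (y - z)))).
  apply: support_le => // x Fx; rewrite !dotZr ler_pM2l//.
  by have := acute _ Fx; rewrite dotBl subr_le0.
rewrite !dotZr ltr_pM2l// -subr_gt0 -dotBl -sqr_enorm exprn_gt0//.
exact: enorm_gt0.
Qed.

(** ** The excess of a placement *)

Section Excess.
Variables (F K : set plane) (Q : 'M[R]_2).
Hypotheses (F0 : F !=set0) (cF : compact F) (vF : @convex_set R plane F).
Hypotheses (K0 : K !=set0) (cK : compact K) (OQ : O2 Q).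

Let gap a u := dot a u + support_fun K (mxact Q^T u) - support_fun F u.

Let gap_continuous a : continuous (gap a).
Proof.
have /compact_enormP[_ [c cB]] := cF; have /compact_enormP[_ [d dB]] := cK.
apply: (@lipschitz_continuous _ _ (enorm a + d + c)) => u v.
have h1 : dot a (u - v) <= enorm a * enorm (u - v) by exact: dot_le_enorm.
have h2 := support_lipschitz (mxact Q^T u) (mxact Q^T v) cK K0 dB.
have h3 := support_lipschitz v u cF F0 cB.
rewrite -mxactB (enorm_mxact _ (O2_tr OQ)) in h2.
rewrite (enormC v u) in h3.
rewrite /gap !mulrDl; rewrite dotBr in h1; lra.
Qed.

Lemma excess_attained a : exists u, [/\ S1 u, excess F (support_fun K) Q a = gap a u &
  forall v, S1 v -> gap a v <= excess F (support_fun K) Q a].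
Proof.
have [u /[!inE] Su um] := compact_EVT_max (S1_nonempty R) (@compact_S1 R)
  (continuous_subspaceT (@gap_continuous a)).
have hub : ubound [set gap a v | v in @S1 R] (gap a u).
  by move=> _ [v Sv <-]; apply: um; rewrite inE.
have e : excess F (support_fun K) Q a = gap a u.
  apply/eqP; rewrite eq_le; apply/andP; split.
    by apply: ge_sup => //; exists (gap a u), u.
  by apply: ub_le_sup; [exists (gap a u) | exists u].
by exists u; split => // v Sv; rewrite e; apply: um; rewrite inE.
Qed.

(** [a + QK] lies in the interior of [F] exactly when its support function is
    strictly below that of [F]: the strict inequality on the compact circle
    leaves a margin, and a point of [a + QK] that is not interior would have
    points outside [F] within that margin, which separation forbids. *)
Lemma excess_lt0P a : excess F (support_fun K) Q a < 0 <->
  [set a + mxact Q x | x in K] `<=` F°.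
Proof.
have gapE u x : dot (a + mxact Q x) u = dot a u + dot x (mxact Q^T u).
  by rewrite dotDl dot_mxact.
have [u0 [Su0 e0 em]] := excess_attained a; split; last first.
  move=> h; rewrite e0 /gap.
  have [x Kx ->] := support_attained (mxact Q^T u0) cK K0.
  have /interior_enormP[e e_gt0 eF] : F° (a + mxact Q x) by apply: h; exists x.
  have : F (a + mxact Q x + (e / 2) *: u0).
    apply: eF; rewrite addrC addKr enormZ Su0 mulr1 gtr0_norm; lra.
  move=> /(support_ge u0 cF); rewrite dotDl gapE dotZl -sqr_enorm Su0.
  by rewrite expr1n; lra.
move=> neg _ [x Kx <-]; set m := - excess F (support_fun K) Q a.
apply/interior_enormP; exists m; first by rewrite /m oppr_gt0.
move=> y ym; apply: contrapT => nFy.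
have [u Su uy] := separation F0 cF vF nFy.
have := em _ Su; rewrite /gap.
have := support_ge (mxact Q^T u) cK Kx.
have := dot_S1_le (y - (a + mxact Q x)) Su.
move: ym; rewrite dotBl gapE /m; lra.
Qed.

Lemma excess_lipschitz a b :
  excess F (support_fun K) Q a - excess F (support_fun K) Q b <= enorm (a - b).
Proof.
have [u [Su -> _]] := excess_attained a; have [_ [_ _ h]] := excess_attained b.
have := h _ Su; have := dot_S1_le (a - b) Su.
rewrite /gap dotBl; lra.
Qed.

(** In the direction of [a], the linear term of the excess is [enorm a], while
    the support functions are bounded on the circle. *)
Lemma excess_coercive : exists c : R, forall a,
  enorm a - c <= excess F (support_fun K) Q a.
Proof.
have /compact_enormP[_ [c cB]] := cF; have /compact_enormP[_ [d dB]] := cK.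
exists (c + d) => a; have [_ [_ _ h]] := excess_attained a.
have [u Su ua] : exists2 u, S1 u & enorm a = dot a u.
  have [->|a0] := eqVneq a 0.
    by have [u Su] := S1_nonempty R; exists u; rewrite // enorm0 dot0l.
  exists ((enorm a)^-1 *: a); first exact: S1_unit.
  by rewrite dotZr -sqr_enorm expr2 mulKf// gt_eqF// enorm_gt0.
have SQu : S1 (mxact Q^T u) by apply: S1_mxact => //; exact: O2_tr.
have := h _ Su; rewrite /gap ua.
have := support_abs cF F0 cB Su; have := support_abs cK K0 dB SQu.
rewrite !ler_norml => /andP[? ?] /andP[? ?]; lra.
Qed.

(** The excess is continuous and grows at infinity like [enorm a], so that only
    a ball of translations matters. *)
Lemma Psi_attained :
  is_min (range (excess F (support_fun K) Q)) (Psi F (support_fun K) Q).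
Proof.
set f := excess F (support_fun K) Q.
have [c hc] := excess_coercive.
have cf : continuous f.
  apply: (@lipschitz_continuous _ _ 1) => a b; rewrite mul1r.
  exact: excess_lipschitz.
have c0 : 0 <= `|f 0| + `|c| by rewrite addr_ge0.
have B0 : [set x : plane | enorm x <= `|f 0| + `|c|] !=set0.
  by exists 0 => /=; rewrite enorm0.
have [a _ am] := compact_EVT_min B0
  (@compact_enorm_ball R _) (continuous_subspaceT cf).
have lb : lbound (range f) (f a).
  move=> _ [b _ <-]; have [bB|bB] := leP (enorm b) (`|f 0| + `|c|).
    by apply: am; rewrite inE.
  have h0 : f a <= f 0 by apply: am; rewrite inE /= enorm0.
  have := hc b; rewrite -/f; have := ler_norm (f 0); have := ler_norm c; lra.
have -> : Psi F (support_fun K) Q = f a.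
  apply/eqP; rewrite eq_le; apply/andP; split.
    by apply: ge_inf; [exists (f a) | exists a].
  by apply: lb_le_inf => //; exists (f a), a.
by split => //; exists a.
Qed.

(** Attainment is what turns a negative infimum into a placement that fits; it
    also shows that the infimum is a genuine lower bound. *)
Lemma Psi_ge0P : 0 <= Psi F (support_fun K) Q <->
  forall a, ~ [set a + mxact Q x | x in K] `<=` F°.
Proof.
have [[a0 _ ea] lb] := Psi_attained; split.
  move=> h a /excess_lt0P; rewrite ltNge => /negP; apply.
  by apply: le_trans h _; apply: lb; exists a.
by move=> h; rewrite -ea leNgt; apply/negP => /excess_lt0P; exact: h.
Qed.

End Excess.

(** The width of a set in a direction is a difference of two of its points
    projected on that direction, hence at most a distance; the distance between
    two points is reached in the direction that joins them. *)
Lemma objectiveC_support K : K !=set0 -> compact K ->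
  objectiveC (support_fun K) = diam K.
Proof.
move=> K0 cK.
have hub : ubound [set support_fun K u + support_fun K (- u) | u in @S1 R] (diam K).
  move=> _ [u Su <-].
  have [x Kx ->] := support_attained u cK K0.
  have [y Ky ->] := support_attained (- u) cK K0.
  rewrite dotNr -dotBl; apply: le_trans (dot_S1_le _ Su) _.
  exact: diam_ge.
have [u0 Su0] := S1_nonempty R.
apply/eqP; rewrite eq_le; apply/andP; split.
  apply: ge_sup => //.
  by exists (support_fun K u0 + support_fun K (- u0)), u0.
apply: diam_le => // x y Kx Ky.
have [u Su ->] : exists2 u, S1 u & enorm (x - y) = dot (x - y) u.
  have [->|a0] := eqVneq (x - y) 0; first by exists u0; rewrite // enorm0 dot0l.
  exists ((enorm (x - y))^-1 *: (x - y)); first exact: S1_unit.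
  by rewrite dotZr -sqr_enorm expr2 mulKf// gt_eqF// enorm_gt0.
apply: (@le_trans _ _ (support_fun K u + support_fun K (- u))).
  by rewrite dotBl -dotNr lerD// support_ge.
by apply: ub_le_sup; [exists (diam K) | exists u].
Qed.

End Support.

(** * Convex hulls of compact sets *)

Section Hull.
Variables (R : realType) (d : nat).
Local Notation E := 'rV[R]_d.
Implicit Types (A B : set E) (x y : E).

Definition combo A n : set E := [set x | exists (f : 'I_n -> E) (w : 'I_n -> R),
  [/\ forall i, A (f i), forall i, 0 <= w i, \sum_i w i = 1 &
      \sum_i w i *: f i = x]].

Definition join A B : set E :=
  [set x | exists (t : R) (a b : E), [/\ 0 <= t, t <= 1, A a & B b] /\
     t *: a + (1 - t) *: b = x].

Lemma combo1 A : combo A 1 = A.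
Proof.
apply/seteqP; split=> x.
  move=> [f [w [Af _]]]; rewrite !big_ord_recl !big_ord0 !addr0 => -> <-.
  by rewrite scale1r.
move=> Ax; exists (fun=> x), (fun=> 1); split => //.
  by rewrite big_ord_recl big_ord0 addr0.
by rewrite big_ord_recl big_ord0 addr0 scale1r.
Qed.

Lemma join_combo A n m : join (combo A n) (combo A m) `<=` combo A (n + m).
Proof.
move=> _ [t [_ [_ [[t0 t1 [f [w [Af w0 w1 <-]]] [g [v [Ag v0 v1 <-]]]] <-]]]].
exists (fun i : 'I_(n + m) => match fintype.split i with inl j => f j | inr k => g k end).
exists (fun i : 'I_(n + m) => match fintype.split i with inl j => t * w j | inr k => (1 - t) * v k end).
have sl (i : 'I_n) : fintype.split (lshift m i) = inl i by apply: (unsplitK (inl i)).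
have sr (i : 'I_m) : fintype.split (rshift n i) = inr i by apply: (unsplitK (inr i)).
split.
- by move=> i; case: fintype.split.
- by move=> i; case: fintype.split => j; rewrite mulr_ge0// subr_ge0.
- rewrite big_split_ord /=.
  under eq_bigr do rewrite sl.
  under [X in _ + X]eq_bigr do rewrite sr.
  by rewrite -!mulr_sumr w1 v1 !mulr1 addrC subrK.
- rewrite big_split_ord /= !scaler_sumr; congr (_ + _); apply: eq_bigr => i _.
    by rewrite sl scalerA.
  by rewrite sr scalerA.
Qed.

(** Splitting off the first point and renormalizing the other weights by their
    sum [s]. *)
Lemma combo_join A n : combo A n.+2 `<=` join A (combo A n.+1).
Proof.
move=> x [f [w [Af w0 w1 <-]]]; rewrite big_ord_recl /= in w1; rewrite big_ord_recl /=.
set s := \sum_i _ in w1; have sE : s = 1 - w ord0 by rewrite -w1 addrC addKr.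
have s0 : 0 <= s by apply: sumr_ge0 => i _.
have [sz|snz] := eqVneq s 0.
  (* no weight is left for the other points, so any second point will do *)
  exists 1, (f ord0), (f ord0); split; first split => //.
    exists (fun=> f ord0), (fun i => (i == ord0)%:R); split => //.
    - by rewrite (bigD1 ord0)//= big1 ?addr0// => i /negPf ->.
    - rewrite (bigD1 ord0)//= big1 ?addr0 ?scale1r// => i /negPf ->.
      by rewrite scale0r.
  have -> : w ord0 = 1 by rewrite -w1 sz addr0.
  rewrite subrr scale0r addr0 big1 ?addr0// => i _.
  by rewrite (psumr_eq0P _ sz) ?scale0r.
exists (w ord0), (f ord0), (\sum_i (s^-1 * w (lift ord0 i)) *: f (lift ord0 i)).
split; first split => //.
- by rewrite -w1 lerDl.
- exists (fun i => f (lift ord0 i)), (fun i => s^-1 * w (lift ord0 i)); split => //.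
    by move=> i; rewrite mulr_ge0// invr_ge0.
  by rewrite -mulr_sumr mulVf.
rewrite -sE scaler_sumr; congr (_ + _); apply: eq_bigr => i _.
by rewrite scalerA mulrA mulfV// mul1r.
Qed.

Lemma comboSE A n : combo A n.+2 = join A (combo A n.+1).
Proof.
apply/seteqP; split; first exact: combo_join.
by have := @join_combo A 1 n.+1; rewrite combo1.
Qed.

(** Caratheodory's reduction: more than [d + 1] points satisfy a nontrivial affine
    relation; subtracting its largest admissible multiple from the weights
    keeps them nonnegative and makes one of them vanish. *)
Lemma combo_reduce A n : (d < n)%N -> combo A n.+1 `<=` combo A n.
Proof.
move=> dn x [f [w [Af w0 w1 <-]]].
(* a row vector in the left kernel of [M] is an affine relation *)
pose M : 'M[R]_(n.+1, 1 + d) := \matrix_i row_mx 1%:M (f i).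
have [mu mu0 muM] : exists2 mu : 'rV[R]_n.+1, mu != 0 & mu *m M = 0.
  have : kermx M != 0.
    rewrite kermx_eq0 /row_free neq_ltn; apply/orP; left.
    by rewrite (leq_ltn_trans (rank_leq_col _)).
  move=> /rowV0Pn[mu /sub_kermxP muM mu0]; by exists mu.
have muf : \sum_i mu ord0 i *: row_mx 1%:M (f i) = 0 :> 'rV[R]_(1 + d).
  rewrite -[RHS]muM mulmx_sum_row; apply: eq_bigr => i _.
  by rewrite rowK.
have muf0 : \sum_i mu ord0 i = 0.
  move: muf => /(congr1 (fun v : 'rV[R]_(1 + d) => v ord0 (lshift d ord0))).
  rewrite summxE mxE => {2}<-; apply: eq_bigr => i _.
  by rewrite mxE row_mxEl mxE mulr1.
have muf1 : \sum_i mu ord0 i *: f i = 0.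
  apply/rowP => j.
  move: muf => /(congr1 (fun v : 'rV[R]_(1 + d) => v ord0 (rshift 1 j))).
  rewrite !summxE !mxE => {2}<-; apply: eq_bigr => i _.
  by rewrite [LHS]mxE [RHS]mxE row_mxEr.
have [i1 i1_gt0] : exists i, 0 < mu ord0 i.
  apply: contrapT => /forallNP npos; move/negP: mu0; apply.
  have np i : 0 <= - mu ord0 i by rewrite oppr_ge0 leNgt; exact/negP.
  have sN : \sum_i - mu ord0 i = 0 by rewrite sumrN muf0 oppr0.
  apply/eqP/rowP => i; rewrite mxE; apply/eqP; rewrite -oppr_eq0; apply/eqP.
  exact: (psumr_eq0P _ sN).
case: (@arg_minP _ _ _ i1 (fun i => 0 < mu ord0 i)
  (fun i => w i / mu ord0 i) i1_gt0) => i0 i0_gt0 imin.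
set s := w i0 / mu ord0 i0 in imin.
have s0 : 0 <= s by rewrite divr_ge0// ltW.
pose v i := w i - s * mu ord0 i.
have v0 i : 0 <= v i.
  rewrite subr_ge0; have [i_gt0|i_le0] := ltP 0 (mu ord0 i).
    by rewrite -ler_pdivlMr//; exact: imin.
  by apply: le_trans (w0 i); rewrite mulr_ge0_le0.
have vi0 : v i0 = 0 by rewrite /v /s mulfVK ?subrr// gt_eqF.
have v1 : \sum_i v i = 1 by rewrite sumrB -mulr_sumr muf0 mulr0 subr0.
have vf : \sum_i v i *: f i = \sum_i w i *: f i.
  under eq_bigr do rewrite scalerBl -scalerA.
  by rewrite sumrB -scaler_sumr muf1 scaler0 subr0.
rewrite -vf.
exists (fun j => f (lift i0 j)), (fun j => v (lift i0 j)); split => //.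
- by rewrite -v1 [RHS](bigD1_ord i0)//= vi0 add0r.
- by rewrite [RHS](bigD1_ord i0)//= vi0 scale0r add0r.
Qed.

Lemma combo_caratheodory A n : combo A (n + d.+1) `<=` combo A d.+1.
Proof.
elim: n => // n ih x; rewrite addSn => /combo_reduce h; apply: ih; apply: h.
by rewrite addnS ltnS leq_addl.
Qed.

Lemma convex_convex_hull A : @convex_set R E (smallest (@convex_set R E) A).
Proof.
apply/convexP => x y t Hx Hy t0 t1 B [cB AB].
by move/convexP : (cB); apply => //; [exact: Hx|exact: Hy].
Qed.

Lemma combo_sub_hull A n : combo A n.+1 `<=` smallest (@convex_set R E) A.
Proof.
elim: n => [|n ih]; first by rewrite combo1; exact: sub_smallest.
rewrite comboSE => _ [t [a [b [[t0 t1 Aa Bb] <-]]]].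
apply: ((convexP _).1 (@convex_convex_hull A)) => //; last exact: ih.
exact: (@sub_smallest _ (@convex_set R E) _ _ (@subset_refl _ A)).
Qed.

Lemma sub_combo A n : A `<=` combo A n.+1.
Proof.
elim: n => [|n ih] x Ax; first by rewrite combo1.
rewrite comboSE; exists 1, x, x; split; first by split => //; exact: ih.
by rewrite subrr scale0r addr0 scale1r.
Qed.

(** Joining two combinations of [d + 1] points gives a combination of twice as
    many, which the reduction brings back to [d + 1]: such combinations are
    closed under joins. *)
Theorem caratheodory A : smallest (@convex_set R E) A = combo A d.+1.
Proof.
apply/seteqP; split; last exact: combo_sub_hull.
apply: smallest_sub; last exact: sub_combo.
apply/convexP => x y t Cx Cy t0 t1; apply: (@combo_caratheodory A d.+1).
by apply: join_combo; exists t, x, y.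
Qed.

Lemma compact_join A B : compact A -> compact B -> compact (join A B).
Proof.
move=> cA cB.
have -> : join A B = (fun p : R * (E * E) => p.1 *: p.2.1 + (1 - p.1) *: p.2.2) @`
    (`[0, 1]%classic `*` (A `*` B)).
  apply/seteqP; split=> x.
    move=> [t [a [b [[t0 t1 Aa Bb] <-]]]]; exists (t, (a, b)) => //.
    by split => //=; rewrite in_itv /= t0.
  move=> [[t [a b]] /= [/= + [Aa Bb]] <-]; rewrite in_itv /= => /andP[t0 t1].
  by exists t, a, b.
apply: continuous_compact; last first.
  by apply: compact_setX; [exact: segment_compact|exact: compact_setX].
apply: continuous_subspaceT => p.
have c1 : q.1 @[q --> p] --> p.1 by exact: cvg_fst.
have c2 : q.2 @[q --> p] --> p.2 by exact: cvg_snd.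
have c21 : q.2.1 @[q --> p] --> p.2.1.
  exact: (cvg_comp _ _ c2 cvg_fst).
have c22 : q.2.2 @[q --> p] --> p.2.2.
  exact: (cvg_comp _ _ c2 cvg_snd).
apply: cvgD; apply: cvgZ => //.
by apply: cvgB => //; exact: cvg_cst.
Qed.

(** A join is a continuous image of a compact set, and [d] joins exhaust the
    hull. *)
Lemma compact_hull A : compact A -> compact (smallest (@convex_set R E) A).
Proof.
move=> cA; rewrite caratheodory.
elim: {2}d => [|n ih]; first by rewrite combo1.
by rewrite comboSE; exact: compact_join.
Qed.

End Hull.

Section PlaneHull.
Variable R : realType.
Local Notation plane := ('rV[R]_2).
Implicit Types (A K : set plane).

Lemma convex_enorm_ball (y : plane) (c : R) :
  @convex_set R plane [set x | enorm (x - y) <= c].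
Proof.
apply/convexP => p q t /= pc qc t0 t1.
have -> : t *: p + (1 - t) *: q - y = t *: (p - y) + (1 - t) *: (q - y).
  by apply: plane_eqP; rewrite !mxE; ring.
apply: le_trans (enormD _ _) _; rewrite !enormZ !ger0_norm// ?subr_ge0//.
have := ler_wpM2l t0 pc.
have := @ler_wpM2l _ (1 - t) _ _ _ qc; rewrite subr_ge0 => /(_ t1); lra.
Qed.

(** Balls being convex, two successive uses of minimality of the hull, one for
    each of the two points, bound their distance. *)
Lemma diam_convex_hull A : A !=set0 -> compact A -> diam (convex_hull A) = diam A.
Proof.
move=> A0 cA; have sA : A `<=` convex_hull A by exact: sub_smallest.
have H0 : convex_hull A !=set0 by case: A0 => x /sA; exists x.
apply/eqP; rewrite eq_le; apply/andP; split; last first.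
  by apply: diam_le => // x y /sA Ax /sA Ay; apply: diam_ge => //; exact: compact_hull.
apply: diam_le => // x y Hx Hy.
have hull_ball y' : A `<=` [set x' | enorm (x' - y') <= diam A] ->
    convex_hull A `<=` [set x' | enorm (x' - y') <= diam A].
  by apply: smallest_sub; exact: convex_enorm_ball.
have h z : A z -> enorm (x - z) <= diam A.
  by move=> Az; apply: hull_ball Hx => p Ap; exact: diam_ge.
by rewrite enormC; apply: hull_ball Hy => p Ap /=; rewrite enormC h.
Qed.

End PlaneHull.

(** * Selection of an optimal convex set *)

Section Selection.
Variable R : realType.
Local Notation plane := ('rV[R]_2).
Implicit Types (x y : plane) (K L : set plane) (U : set (set (set plane))).

(** The limit along [U] of the sets themselves, in the sense of Kuratowski. *)
Definition ultralimit U : set plane :=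
  [set x | forall e : R, 0 < e -> U [set K | exists2 y, K y & enorm (y - x) < e]].

(** By compactness of balls, points selected in the members of a bounded family
    accumulate along the ultrafilter; an ultrafilter does not distinguish
    accumulation from convergence. *)
Lemma ultralimit_select U (c : R) (f : set plane -> plane) : UltraFilter U ->
  U [set K | K (f K) /\ enorm (f K) <= c] ->
  exists2 x, ultralimit U x & forall e : R, 0 < e -> U [set K | enorm (f K - x) < e].
Proof.
move=> UU Uf.
have [x [_ clx]] : [set x : plane | enorm x <= c] `&` cluster (fmap f U) !=set0.
  apply: compact_enorm_ball; rewrite /fmap /=.
  by apply: filterS Uf => K [].
have near e : 0 < e -> U [set K | enorm (f K - x) < e].
  move=> e0; have [//|UC] := in_ultra_setVsetC [set K | enorm (f K - x) < e] UU.
  have fUC : (fmap f U) [set y | ~ enorm (y - x) < e] by [].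
  have [|y [ne ye]] := clx _ [set y | enorm (y - x) < e] fUC.
    by apply/nbhs_enormP; exists e.
  by case: ne.
exists x => // e e0.
by apply: filterS2 Uf (near _ e0) => K [Kf _] fx; exists (f K).
Qed.

(** Blaschke's selection theorem, in the form needed: the limit [L] absorbs some
    member of the family up to any [e], since otherwise points at distance at
    least [e] from [L] could be selected in all members, and would accumulate
    outside [L]. *)
Lemma blaschke (C : set (set plane)) (c D : R) :
  (forall K, C K -> [/\ K !=set0, @convex_set R plane K &
                        forall x, K x -> enorm x <= c]) ->
  (forall e, 0 < e -> exists2 K, C K & diam K < D + e) ->
  exists L, [/\ K2 L, diam L <= D & forall e, 0 < e ->
    exists2 K, C K & forall x, K x -> exists2 y, L y & enorm (x - y) < e].
Proof.
move=> CK CD.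
pose B e := [set K | C K /\ diam K < D + e].
have FB : Filter (filter_from [set e : R | 0 < e] B).
  apply: filter_from_filter; first by exists 1 => /=.
  move=> i j /= i0 j0; exists (Num.min i j) => /=; first by rewrite lt_min i0.
  move=> K [KC]; rewrite minElt; case: ifPn => [ij|].
    by move=> h; split; split => //; lra.
  by rewrite -leNgt => ij h; split; split => //; lra.
have PB : ProperFilter (filter_from [set e : R | 0 < e] B).
  by apply: filter_from_proper => e /= e0; have [K] := CD _ e0; exists K.
have [U [UU BU]] := ultraFilterLemma PB.
have UB e : 0 < e -> U (B e) by move=> e0; apply: BU; exists e.
have UC : U C by apply: filterS (UB 1 ltr01) => K [].
set L := ultralimit U.
have L0 : L !=set0.
  have [|x Lx _] := @ultralimit_select U c (xget 0) UU; last by exists x.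
  apply: filterS UC => K /CK[K0 _ Kc].
  by have Kx : K (xget 0 K) := xgetPex 0 K0; split => //; exact: Kc.
have Lc x : L x -> enorm x <= c.
  move=> Lx; apply/ler_addgt0Pr => e e0.
  have [K [/CK[_ _ Kc] [y Ky yx]]] := filter_ex (filterI UC (Lx _ e0)).
  by have := Kc _ Ky; have := enormB_le x y; rewrite enormC; lra.
have Lcl : closed L.
  move=> x /closure_enormP clx e e0; have e2 : 0 < e / 2 by rewrite divr_gt0.
  have [y Ly yx] := clx _ e2.
  apply: filterS (Ly _ e2) => K [z Kz zy]; exists z => //.
  by have := enorm_triangle y z x; lra.
have Lcv : @convex_set R plane L.
  apply/convexP => x y t Lx Ly t0 t1 e e0.
  have e2 : 0 < e / 2 by rewrite divr_gt0.
  apply: filterS2 (filterI UC (Lx _ e2)) (Ly _ e2).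
  move=> K [/CK[_ /convexP Kv _] [x' Kx' x'x]] [y' Ky' y'y].
  exists (t *: x' + (1 - t) *: y'); first exact: Kv.
  have -> : t *: x' + (1 - t) *: y' - (t *: x + (1 - t) *: y) =
            t *: (x' - x) + (1 - t) *: (y' - y).
    by apply: plane_eqP; rewrite !mxE; ring.
  apply: le_lt_trans (enormD _ _) _; rewrite !enormZ !ger0_norm// ?subr_ge0//.
  have := ler_wpM2l t0 (ltW x'x).
  have := @ler_wpM2l _ (1 - t) _ _ _ (ltW y'y); rewrite subr_ge0 => /(_ t1); lra.
exists L; split.
- by split => //; apply/compact_enormP; split => //; exists c.
- apply: diam_le => // x y Lx Ly; apply/ler_addgt0Pr => e e0.
  have e3 : 0 < e / 3 by rewrite divr_gt0.
  have [K [[[KC Kd] [x' Kx' x'x]] [y' Ky' y'y]]] :=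
    filter_ex (filterI (filterI (UB _ e3) (Lx _ e3)) (Ly _ e3)).
  have [_ _ Kc] := CK _ KC.
  have := diam_ub Kc Kx' Ky'.
  have := enorm_triangle x' x y; have := enorm_triangle y' x' y.
  by rewrite (enormC x x'); lra.
- move=> e e0; apply: contrapT => /forall2NP far.
  pose far_pts K := [set x | K x /\ forall y, L y -> e <= enorm (x - y)].
  have farP K : C K -> far_pts K (xget 0 (far_pts K)).
    move=> KC; apply: xgetPex; have [//|/existsNP[x /not_implyP[Kx hx]]] := far K.
    exists x; split => // y Ly; rewrite leNgt; apply/negP => xy.
    by apply: hx; exists y.
  have [|x Lx xlim] := @ultralimit_select U c (fun K => xget 0 (far_pts K)) UU.
    apply: filterS UC => K KC; have [Kx _] := farP _ KC; split => //.
    by have [_ _ Kc] := CK _ KC; exact: Kc.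
  have [K [/farP[_ h] /=]] := filter_ex (filterI UC (xlim _ e0)).
  by rewrite ltNge h.
Qed.

End Selection.

Section Unfit.
Variable R : realType.
Local Notation plane := ('rV[R]_2).
Implicit Types (x y v : plane) (A K F L : set plane).

Lemma unfit_sub F A K : A `<=` K -> unfit F A -> unfit F K.
Proof.
move=> AK uA a Q OQ sub; apply: (uA a Q OQ) => _ [x Ax <-].
by apply: sub; exists x => //; exact: AK.
Qed.

Lemma unfit_translate F K v : unfit F K -> unfit F [set x + v | x in K].
Proof.
move=> uK a Q OQ sub; apply: (uK (a + mxact Q v) Q OQ) => _ [x Kx <-].
rewrite -addrA (addrC (mxact Q v)) -mxactD; apply: sub.
by exists (x + v) => //; exists x.
Qed.

Lemma diam_translate K v : diam [set x + v | x in K] = diam K.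
Proof.
rewrite /diam; congr sup; apply/seteqP; split => t.
  move=> [_ [x Kx <-] [_ [y Ky <-] <-]]; exists x => //; exists y => //.
  by rewrite opprD addrACA subrr addr0.
move=> [x Kx [y Ky <-]]; exists (x + v); first by exists x.
exists (y + v); first by exists y.
by rewrite opprD addrACA subrr addr0.
Qed.

Lemma K2_translate K v : K2 K -> K2 [set x + v | x in K].
Proof.
move=> [[x0 Kx0] cK /convexP vK]; split.
- by exists (x0 + v), x0.
- apply: continuous_compact => //; apply: continuous_subspaceT => x.
  by apply: continuousD; [move=> ?; exact: cvg_id|exact: cst_continuous].
- apply/convexP => _ _ t [x Kx <-] [y Ky <-] t0 t1.
  exists (t *: x + (1 - t) *: y); first exact: vK.
  by apply: plane_eqP; rewrite !mxE; ring.
Qed.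

Lemma feasibleB_translate F K v : feasibleB F K -> feasibleB F [set x + v | x in K].
Proof. by move=> [? ?]; split; [exact: K2_translate|exact: unfit_translate]. Qed.

Lemma diam_ge0 K : K !=set0 -> compact K -> 0 <= diam K.
Proof.
move=> [x Kx] cK; apply: le_trans (diam_ge cK Kx Kx); exact: enorm_ge0.
Qed.

Lemma body_nonempty F : convex_body F -> F !=set0.
Proof. by move=> [_ _ [x /interior_subset Fx]]; exists x. Qed.

(** A set of larger diameter than [F] does not fit; balls are such sets. *)
Lemma feasibleB_nonempty F : convex_body F -> feasibleB F !=set0.
Proof.
move=> Fb; have [cF _ _] := Fb; have /compact_enormP[_ [c cB]] := cF.
have c0 : 0 <= c.
  have [x Fx] := body_nonempty Fb.
  exact: le_trans (enorm_ge0 x) (cB _ Fx).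
exists [set x | enorm x <= c + 1]; split; first split.
- by exists 0 => /=; rewrite enorm0 addr_ge0.
- exact: compact_enorm_ball.
- have := @convex_enorm_ball R 0 (c + 1); congr (convex_set _).
  by apply/seteqP; split => x /=; rewrite subr0.
move=> a Q OQ sub; have [u Su] := S1_nonempty R.
have fit (s : R) : `|s| <= c + 1 -> enorm (a + mxact Q (s *: u)) <= c.
  move=> sc; apply: cB; apply: interior_subset; apply: sub.
  by exists (s *: u) => //=; rewrite enormZ Su mulr1.
have h1 := fit (c + 1); have h2 := fit (- (c + 1)).
rewrite normrN in h2.
rewrite ger0_norm ?addr_ge0// in h1 h2.
have := enormB_le (a + mxact Q ((c + 1) *: u)) (a + mxact Q (- (c + 1) *: u)).
have := enormD (a + mxact Q ((c + 1) *: u)) (- (a + mxact Q (- (c + 1) *: u))).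
rewrite enormN opprD addrACA subrr add0r -mxactB -scalerBl opprK.
rewrite (enorm_mxact _ OQ) enormZ Su mulr1 ger0_norm; last lra.
by have := h1 (lexx _); have := h2 (lexx _); lra.
Qed.

(** Being unfit passes to the limit: if a copy of [L] fits, its support function
    has a margin below that of [F], which the support functions of sets close
    enough to [L] respect. *)
Lemma exists_minB F : convex_body F ->
  exists2 L, feasibleB F L & forall K, feasibleB F K -> diam L <= diam K.
Proof.
move=> Fb; have [cF vF _] := Fb; have F0 := body_nonempty Fb.
set S := [set diam K | K in feasibleB F].
have [K0 K0f] := feasibleB_nonempty Fb.
have Slb : lbound S 0 by move=> _ [K [[K_0 cK _] _] <-]; exact: diam_ge0.
have iS : has_inf S by split; [exists (diam K0), K0|exists 0].
set D := inf S.
pose C := [set K | [/\ feasibleB F K, K 0 & diam K <= D + 1]].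
have [||L [L2 LD near]] := @blaschke R C (D + 1) D.
- move=> K [[[K_0 cK vK] _] K0' Kd]; split => // x Kx.
  apply: le_trans Kd; rewrite -(subr0 x); exact: diam_ge.
- move=> e e0.
  have m0 : 0 < Num.min e 1 by rewrite lt_min e0 ltr01.
  have [_ [K Kf <-] Kd] := inf_adherent m0 iS.
  have [[[x Kx] cK vK] _] := Kf.
  have [m1 m2] : Num.min e 1 <= e /\ Num.min e 1 <= 1.
    by split; rewrite ge_min lexx ?orbT.
  (* the minimizing sequence is moved to contain the origin, hence is bounded *)
  exists [set y + (- x) | y in K]; last by rewrite diam_translate /D; lra.
  split; first exact: feasibleB_translate.
    by exists x => //; rewrite subrr.
  by rewrite diam_translate /D; lra.
exists L; last first.
  move=> K Kf; apply: le_trans LD _; apply: ge_inf; first by exists 0.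
  by exists K.
split => // a Q OQ; have [L0 cL vL] := L2.
move=> /(excess_lt0P F0 cF vF L0 cL OQ) neg.
set m := - excess F (support_fun L) Q a.
have m2 : 0 < m / 2 by rewrite divr_gt0// oppr_gt0.
have [K [[[K_0 cK _] uK] _ _] KL] := near _ m2.
apply: (uK a Q OQ); apply/(excess_lt0P F0 cF vF K_0 cK OQ).
have [u [Su -> _]] := excess_attained F0 cF K_0 cK OQ a.
have [_ [_ _ h]] := excess_attained F0 cF L0 cL OQ a; have := h u Su.
have : support_fun K (mxact Q^T u) <= support_fun L (mxact Q^T u) + m / 2.
  apply: support_le => // x Kx; have [y Ly xy] := KL x Kx.
  have := support_ge (mxact Q^T u) cL Ly.
  have := dot_S1_le (x - y) (S1_mxact (O2_tr OQ) Su); rewrite dotBl; lra.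
by move: m2; rewrite /m; lra.
Qed.

End Unfit.

(** * Paths *)

Section Paths.
Variable R : realType.
Local Notation plane := ('rV[R]_2).
Implicit Types (x y v : plane) (A K F L : set plane) (g : R -> plane).

Lemma isometry_continuous (f : plane -> plane) :
  (forall x y, enorm (f x - f y) = enorm (x - y)) -> continuous f.
Proof.
move=> fi x B /nbhs_enormP[e e0 eB]; apply/nbhs_enormP; exists e => // y yx.
by apply: eB; rewrite fi.
Qed.

Lemma within_comp (A : set R) g (f : plane -> plane) :
  {within A, continuous g} -> continuous f -> {within A, continuous (f \o g)}.
Proof. by move=> cg cf t; apply: (@continuous_comp (subspace A) plane plane g f t (cg t)); exact: cf. Qed.

Lemma objectiveAE g : objectiveA g = diam (trace g).
Proof.
rewrite /objectiveA /diam; congr sup; apply/seteqP; split => r.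
  move=> [s s01 [t t01 <-]]; exists (g s); first by exists s.
  by exists (g t) => //; exists t.
move=> [_ [s s01 <-] [_ [t t01 <-] <-]].
by exists s => //; exists t.
Qed.

Lemma mem01_0 : `[0, 1]%classic (0 : R).
Proof. by rewrite /= in_itv /= lexx ler01. Qed.

Lemma trace_nonempty g : trace g !=set0.
Proof. by exists (g 0), 0 => //; exact: mem01_0. Qed.

Lemma compact_trace g : {within `[0, 1], continuous g} -> compact (trace g).
Proof. by move=> cg; apply: continuous_compact => //; exact: segment_compact. Qed.

Lemma trace_translate g v : trace (fun t => g t + v) = [set x + v | x in trace g].
Proof.
apply/seteqP; split => x; first by move=> [t t01 <-]; exists (g t) => //; exists t.
by move=> [_ [t t01 <-] <-]; exists t.
Qed.

Lemma closed_boundaryE F : closed F -> boundary F = F `\` F°.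
Proof. by move=> /closure_id cF; rewrite /boundary -cF. Qed.

Lemma closed_boundary F : closed (boundary F).
Proof.
rewrite /boundary setDE; apply: closedI; first exact: closed_closure.
by rewrite closedC; exact: open_interior.
Qed.

(** Translating a point that maximizes a linear form leads out of [F]. *)
Lemma boundary_nonempty F : compact F -> F !=set0 -> boundary F !=set0.
Proof.
move=> cF F0; have [u Su] := S1_nonempty R.
have [x Fx xm] := support_attained u cF F0.
exists x; rewrite closed_boundaryE; last exact: compactK_closed.
split => // /interior_enormP[e e0 eF].
have : F (x + (e / 2) *: u).
  apply: eF; rewrite addrC addKr enormZ Su mulr1 gtr0_norm; lra.
move=> /(support_ge u cF); rewrite xm dotDl dotZl -sqr_enorm Su expr1n; lra.
Qed.

(** Off the boundary the trace meets [F] and its interior in the same set, which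
    is then both open and closed in the connected trace. *)
Lemma crossing F g : closed F -> {within `[0, 1], continuous g} -> F (g 0) ->
  ~ trace g `<=` F° -> exists2 t, `[0, 1]%classic t & boundary F (g t).
Proof.
move=> clF cg F0 nsub; rewrite closed_boundaryE//.
apply: contrapT => /forall2NP nb.
have inF x : trace g x -> F x -> F° x.
  move=> [t t01 <-] Fgt; apply: contrapT => nF.
  by have [|] := nb t; [exact|apply].
apply: nsub => x tx.
have e : trace g `&` F° = trace g.
  apply: (connected_continuous_connected (@segment_connected R 0 1) cg).
  - exists (g 0); split; first by exists 0 => //; exact: mem01_0.
    by apply: inF => //; exists 0 => //; exact: mem01_0.
  - by exists F° => //; exact: open_interior.
  - exists F => //; apply/seteqP; split => y [ty Fy]; split => //.
      exact: interior_subset.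
    exact: inF.
by rewrite -e in tx; case: tx.
Qed.

Lemma dist_ge0 x A : 0 <= dist x A.
Proof.
have [->|/set0P A0] := eqVneq A set0.
  by rewrite /dist (_ : [set _ | y in set0] = set0) ?inf0// image_set0.
apply: lb_le_inf; first by case: A0 => y Ay; exists (enorm (x - y)), y.
by move=> _ [y _ <-]; exact: enorm_ge0.
Qed.

(** The isometry [y |-> x + Q y] turns the distance in question into the distance
    to the boundary itself, which is closed. *)
Lemma dist0P F x w Q : O2 Q -> boundary F !=set0 ->
  dist w [set mxact Q^T (y - x) | y in boundary F] = 0 <->
  boundary F (x + mxact Q w).
Proof.
move=> OQ bF0; set A := [set _ | _ in _].
have copyE y : enorm (w - mxact Q^T (y - x)) = enorm (y - (x + mxact Q w)).
  rewrite -(enorm_mxact _ OQ) mxactB mxactKV// enormC; congr enorm.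
  by rewrite opprD addrA.
split=> [d0|bx].
  apply: closed_boundary; apply/closure_enormP => e e0.
  have iA : has_inf [set enorm (w - y) | y in A].
    split; last by exists 0 => _ [y _ <-]; exact: enorm_ge0.
    by case: bF0 => y By; exists (enorm (w - mxact Q^T (y - x))), (mxact Q^T (y - x)) => //; exists y.
  have [_ [_ [y By <-] <-]] := inf_adherent e0 iA.
  by rewrite -/(dist w A) d0 add0r copyE => ye; exists y.
apply/eqP; rewrite eq_le dist_ge0 andbT; apply: ge_inf.
  by exists 0 => _ [y _ <-]; exact: enorm_ge0.
exists (mxact Q^T (x + mxact Q w - x)); first by exists (x + mxact Q w).
by rewrite copyE subrr enorm0.
Qed.

Lemma feasibleA_meets F g (x : plane) (Q : 'M[R]_2) : boundary F !=set0 -> O2 Q ->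
  is_min [set dist (g t) [set mxact Q^T (y - x) | y in boundary F]
         | t in `[0, 1]%classic] 0 <->
  exists2 t, `[0, 1]%classic t & boundary F (x + mxact Q (g t)).
Proof.
move=> bF0 OQ; split.
  by move=> [[t t01 /(dist0P _ _ OQ bF0) b] _]; exists t.
move=> [t t01 /(dist0P _ _ OQ bF0) d0]; split; first by exists t.
by move=> _ [s _ <-]; exact: dist_ge0.
Qed.

(** A copy of the path that fits has its base point, the image of [0], in [F]:
    the placements tested in (A) are all that matter. *)
Lemma feasibleA_escape F g : convex_body F -> feasibleA F g -> escape_path F g.
Proof.
move=> Fb [cg g0 g1 meets]; have [cF _ _] := Fb.
have bF0 := boundary_nonempty cF (body_nonempty Fb).
split; first by split; rewrite // g0 g1.
move=> a Q OQ sub.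
have Fa : F a.
  apply: interior_subset; apply: sub; exists 0; last by rewrite /mxact mul0mx addr0.
  by exists 0; [exact: mem01_0|].
have [t t01 [_ nF]] := (feasibleA_meets _ _ bF0 OQ).1 (meets a Q Fa OQ).
by apply: nF; apply: sub; exists (g t) => //; exists t.
Qed.

(** A copy based at a point of [F] leaves the interior of [F], so it crosses the
    boundary. *)
Lemma escape_feasibleA F g : convex_body F -> escape_path F g ->
  feasibleA F (fun t => g t - g 0).
Proof.
move=> Fb [[cg g01] ug]; have [cF _ _] := Fb.
have bF0 := boundary_nonempty cF (body_nonempty Fb).
split; [|by rewrite subrr|by rewrite g01 subrr|].
  apply: (within_comp (f := fun x => x - g 0)) cg _.
  by apply: isometry_continuous => x y; rewrite opprB addrA subrK.
move=> x Q Fx OQ; apply/feasibleA_meets => //.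
apply: (crossing (g := fun t => x + mxact Q (g t - g 0))).
- exact: compactK_closed.
- apply: (within_comp (f := fun y => x + mxact Q (y - g 0))) cg _.
  apply: isometry_continuous => y z.
  rewrite opprD addrACA subrr add0r -mxactB enorm_mxact//; congr enorm.
  by rewrite opprB addrA subrK.
- by rewrite subrr /mxact mul0mx addr0.
- move=> sub; have u0 : unfit F [set y - g 0 | y in trace g] by exact: unfit_translate.
  apply: (u0 x Q OQ) => _ [_ [_ [t t01 <-] <-] <-].
  by apply: sub; exists t.
Qed.

End Paths.

(** * Polar coordinates on the circle *)

Section Circle.
Variable R : realType.
Local Notation plane := ('rV[R]_2).
Implicit Types (x y u : plane) (s t : R).

Lemma circle_point0 t : circle_point t ord0 ord0 = cos t.
Proof. by rewrite mxE. Qed.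

Lemma circle_point1 t : circle_point t ord0 ord_max = sin t.
Proof. by rewrite mxE. Qed.

Lemma S1_circle_point t : S1 (circle_point t).
Proof.
by rewrite /S1 /= /enorm dotE circle_point0 circle_point1 -!expr2 cos2Dsin2 sqrtr1.
Qed.

Lemma circle_point_2pi : circle_point (2 * pi) = circle_point 0 :> plane.
Proof.
apply: plane_eqP; rewrite ?circle_point0 ?circle_point1 mulr_natl.
  by rewrite cos2pi cos0.
by rewrite sin2pi sin0.
Qed.

Lemma continuous_plane (T : topologicalType) (f : T -> plane) :
  continuous (fun p => f p ord0 ord0) -> continuous (fun p => f p ord0 ord_max) ->
  continuous f.
Proof.
move=> c0 c1 p B /nbhs_enormP[e e0 eB].
have e3 : 0 < e / 3 by rewrite divr_gt0.
suff : \forall q \near p, B (f q) by [].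
near=> q; apply: eB; rewrite enormC.
have q0 : `|f p ord0 ord0 - f q ord0 ord0| < e / 3.
  by near: q; exact: (iffLR (@cvgrPdist_lt _ _ _ (nbhs p) _ _ _) (c0 p)).
have q1 : `|f p ord0 ord_max - f q ord0 ord_max| < e / 3.
  by near: q; exact: (iffLR (@cvgrPdist_lt _ _ _ (nbhs p) _ _ _) (c1 p)).
apply: (@le_lt_trans _ _ (2 * (e / 3))); last lra.
apply: enorm_le_coord => j; rewrite !mxE.
have [->|->] : j = ord0 \/ j = ord_max.
  by case: j => [[|[|//]] h]; [left|right]; apply: val_inj.
  exact: ltW.
exact: ltW.
Unshelve. all: by end_near. Qed.

Lemma circle_point_continuous : continuous (@circle_point R).
Proof.
apply: continuous_plane.
  by under eq_fun do rewrite circle_point0; exact: continuous_cos.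
by under eq_fun do rewrite circle_point1; exact: continuous_sin.
Qed.

Lemma continuous_circle (f : plane -> R) :
  continuous f -> continuous (fun t => f (circle_point t)).
Proof.
move=> cf t; apply: (continuous_comp (f := @circle_point R)); last exact: cf.
exact: circle_point_continuous.
Qed.

(** The cosine of the difference of the angles is 1, so the sine of half that
    difference vanishes. *)
Lemma circle_point_inj s t : 0 <= s -> s < 2 * pi -> 0 <= t -> t < 2 * pi ->
  circle_point s = circle_point t :> plane -> s = t.
Proof.
wlog st : s t / s <= t.
  move=> wl s0 s1 t0 t1 e; have [st|/ltW ts] := leP s t; first exact: wl.
  by apply/esym; apply: wl.
move=> s0 s1 t0 t1 e.
have c : cos (t - s) = 1.
  rewrite cosB -(circle_point0 s) -(circle_point1 s) e circle_point0 circle_point1.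
  by rewrite -!expr2 cos2Dsin2.
apply/eqP; rewrite eq_le st /= leNgt; apply/negP => lt_st.
have h : 0 < (t - s) / 2 < pi by apply/andP; split; lra.
have := exprn_gt0 2 (sin_gt0_pi h).
have := cos_mulr2n ((t - s) / 2); have := cos2Dsin2 ((t - s) / 2).
have -> : (t - s) / 2 *+ 2 = t - s by rewrite -mulr_natr divfK.
rewrite c; lra.
Qed.

(** The arc cosine gives the angle in the upper half circle, and its complement
    to a full turn in the lower one. *)
Lemma circle_point_surj u : S1 u -> exists2 t, 0 <= t < 2 * pi & circle_point t = u.
Proof.
move=> Su; set a := u ord0 ord0; set b := u ord0 ord_max.
have ab : a ^+ 2 + b ^+ 2 = 1.
  by have := sqr_enorm u; rewrite Su dotE expr1n -!expr2 => ->.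
have a1 : -1 <= a <= 1.
  by rewrite -ler_norml -Su; exact: enorm_coord_le.
have aI : a \in `[-1, 1] by rewrite in_itv.
have [ac0 acpi] := (acos_ge0 a1, acos_lepi a1).
have ppos := pi_gt0 R.
have sac : sin (acos a) = `|b|.
  by rewrite sin_acos// -sqrtr_sqr; congr Num.sqrt; lra.
have [b0|b0] := leP 0 b.
  exists (acos a); first by apply/andP; split => //; lra.
  apply: plane_eqP; first by rewrite circle_point0 acosK.
  by rewrite circle_point1 sac ger0_norm.
have ac_gt0 : acos a != 0.
  apply/eqP => e; move: sac; rewrite e sin0 => /esym/eqP; rewrite normr_eq0.
  by rewrite lt_eqF.
exists (2 * pi - acos a).
  by apply/andP; split; [lra|rewrite ltrBlDr ltrDl lt_neqAle eq_sym ac_gt0].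
apply: plane_eqP; rewrite ?circle_point0 ?circle_point1 mulr_natl.
  by rewrite cosB cos2pi sin2pi mul1r mul0r addr0 acosK.
rewrite sinB sin2pi cos2pi mul0r mul1r sub0r sac ltr0_norm// opprK.
by [].
Qed.

End Circle.

(** * The boundary curve of a convex set with interior points *)

Section Gauge.
Variable R : realType.
Local Notation plane := ('rV[R]_2).
Implicit Types (x y u v w : plane).
Variables (K : set plane) (o : plane) (r : R).
Hypotheses (cK : compact K) (vK : @convex_set R plane K) (r0 : 0 < r).
Hypothesis (ball_o : forall x, enorm (x - o) <= r -> K x).

(** The support function relative to [o], positive because [o] is interior. *)
Definition height u := support_fun K u - dot o u.

(** The Minkowski gauge of [K] with respect to [o], written as the supremum of
    the linear forms that define the half-planes containing [K]. This makes
    homogeneity and the Lipschitz bound immediate; that its unit ball is [K] is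
    the separation theorem. *)
Definition gauge v := sup [set dot v u / height u | u in @S1 R].

Let K0 : K !=set0.
Proof. by exists o; apply: ball_o; rewrite subrr enorm0 ltW. Qed.

Lemma height_ge u : S1 u -> r <= height u.
Proof.
move=> Su; have Ku : K (o + r *: u).
  by apply: ball_o; rewrite addrC addKr enormZ Su mulr1 gtr0_norm.
have := support_ge u cK Ku.
by rewrite dotDl dotZl -sqr_enorm Su expr1n /height; lra.
Qed.

Let height_gt0 u : S1 u -> 0 < height u.
Proof. by move=> /height_ge; exact: lt_le_trans. Qed.

Lemma gauge_ge v u : S1 u -> dot v u <= gauge v * height u.
Proof.
move=> Su; rewrite -ler_pdivrMr ?height_gt0//; apply: ub_le_sup; last by exists u.
exists (enorm v / r) => _ [w Sw <-].
rewrite ler_pdivrMr ?height_gt0// mulrAC ler_pdivlMr//.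
apply: (@le_trans _ _ (enorm v * r)).
  by rewrite ler_pM2r// dot_S1_le.
by rewrite ler_wpM2l ?enorm_ge0// height_ge.
Qed.

Lemma gauge_le v (c : R) : (forall u, S1 u -> dot v u <= c * height u) -> gauge v <= c.
Proof.
move=> h; have [u Su] := S1_nonempty R.
apply: ge_sup; first by exists (dot v u / height u), u.
by move=> _ [w Sw <-]; rewrite ler_pdivrMr ?height_gt0// h.
Qed.

(** A point outside [K] is separated from it by some [u], where the corresponding
    linear form exceeds 1. *)
Lemma gauge_le1 v : K (o + v) <-> gauge v <= 1.
Proof.
split=> [Kv|g1].
  apply: gauge_le => u Su; rewrite mul1r /height.
  by have := support_ge u cK Kv; rewrite dotDl; lra.
apply: contrapT => nK; have [u Su] := separation K0 cK vK nK.
have := gauge_ge v Su; have := height_gt0 Su.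
move=> h_gt0 vh; have : gauge v * height u <= height u by rewrite ler_piMl// ltW.
by move: vh; rewrite dotDl /height; lra.
Qed.

Lemma gaugeZ (t : R) v : 0 < t -> gauge (t *: v) = t * gauge v.
Proof.
move=> t0.
have le (s : R) w : 0 < s -> gauge (s *: w) <= s * gauge w.
  move=> s0; apply: gauge_le => u Su.
  by rewrite dotZl -mulrA ler_pM2l// gauge_ge.
apply/eqP; rewrite eq_le le//= -[X in _ * gauge X](scalerK (lt0r_neq0 t0)).
by rewrite -ler_pdivlMl// le ?invr_gt0.
Qed.

Lemma gauge_lipschitz v w : gauge v - gauge w <= r^-1 * enorm (v - w).
Proof.
rewrite lerBlDr; apply: gauge_le => u Su; rewrite mulrDl.
rewrite -[X in dot X _](subrK w v) dotDl lerD ?gauge_ge//.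
apply: le_trans (dot_S1_le _ Su) _.
rewrite mulrAC ler_peMl ?enorm_ge0// mulrC ler_pdivlMr// mul1r.
exact: height_ge.
Qed.

Lemma gauge_continuous : continuous gauge.
Proof. exact: lipschitz_continuous gauge_lipschitz. Qed.

Lemma gauge_gt0 v : v != 0 -> 0 < gauge v.
Proof.
move=> v0; have Su := S1_unit v0; have := gauge_ge v Su.
rewrite dotZr -sqr_enorm expr2 mulKf ?gt_eqF ?enorm_gt0// => h.
have := lt_le_trans (enorm_gt0 v0) h; rewrite pmulr_lgt0//.
exact: height_gt0.
Qed.

(** Interior points may be pushed slightly away from [o] inside [K], which scales
    the gauge; conversely, a gauge below 1 stays so nearby. *)
Lemma gauge_lt1 v : K° (o + v) <-> gauge v < 1.
Proof.
split=> [/interior_enormP[e e0 eK]|g1].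
  have [->|v0] := eqVneq v 0.
    apply: (@le_lt_trans _ _ 0) => //; apply: gauge_le => u Su.
    by rewrite dot0l mul0r.
  have n0 : 0 < enorm v by exact: enorm_gt0.
  (* [o + (1 + t) *: v] is at distance [e / 2] from [o + v] *)
  set t := e / (2 * enorm v); have t0 : 0 < t by rewrite divr_gt0// mulr_gt0.
  have : K (o + (1 + t) *: v).
    apply: eK; rewrite opprD addrACA subrr add0r -{2}(scale1r v) -scalerBl.
    rewrite addrC addKr enormZ gtr0_norm// /t invfM mulrA mulfVK ?gt_eqF//; lra.
  move/gauge_le1; rewrite gaugeZ; last by rewrite addr_gt0.
  have := mulr_gt0 t0 (gauge_gt0 v0); rewrite mulrDl mul1r; lra.
apply/interior_enormP; exists (r * (1 - gauge v)); first by rewrite mulr_gt0// subr_gt0.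
move=> y yv; rewrite -(subrK o y) addrC; apply/gauge_le1.
have := gauge_lipschitz (y - o) v.
have -> : y - o - v = y - (o + v) by rewrite opprD addrA.
move: yv; rewrite -ltr_pdivrMl//; lra.
Qed.

Lemma gauge_eq1 v : boundary K (o + v) <-> gauge v = 1.
Proof.
rewrite (closed_boundaryE (compactK_closed cK)); split.
  move=> [/gauge_le1 g1 nK]; apply/eqP; rewrite eq_le g1 /= leNgt.
  by apply/negP => /gauge_lt1.
by move=> g1; split; [apply/gauge_le1; rewrite g1|move=> /gauge_lt1; rewrite g1 ltxx].
Qed.

(** Dividing a direction by its gauge leads to the boundary. *)
Definition radial t := o + (gauge (circle_point (2 * pi * t)))^-1 *:
  circle_point (2 * pi * t).

Let circle_neq0 t : circle_point t != 0 :> plane.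
Proof.
apply/eqP => e; have := S1_circle_point t; rewrite /S1 /= e enorm0 => /esym/eqP.
by rewrite oner_eq0.
Qed.

Let gauge_circle_gt0 t : 0 < gauge (circle_point t).
Proof. exact: gauge_gt0 (circle_neq0 _). Qed.

Lemma radial_boundary t : boundary K (radial t).
Proof. by apply/gauge_eq1; rewrite gaugeZ ?invr_gt0// mulVf// gt_eqF. Qed.

Lemma radial_continuous : continuous radial.
Proof.
move=> t.
have cc : circle_point (2 * pi * s) @[s --> t] --> (circle_point (2 * pi * t) : plane).
  apply: (continuous_comp (f := fun s : R => 2 * pi * s) (g := @circle_point R)).
    exact: mulrl_continuous.
  exact: circle_point_continuous.
have cg : gauge (circle_point (2 * pi * s)) @[s --> t] -->
    gauge (circle_point (2 * pi * t)).
  apply: (continuous_comp (f := fun s : R => circle_point (2 * pi * s))) => //.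
  exact: gauge_continuous.
apply: cvgD; first exact: cvg_cst.
apply: cvgZ => //; apply: cvgV => //.
by rewrite gt_eqF.
Qed.

Lemma radial_trace : trace radial = boundary K.
Proof.
apply/seteqP; split => x; first by move=> [t _ <-]; exact: radial_boundary.
move=> bx; set v := x - o; have xE : x = o + v by rewrite addrC subrK.
have g1 : gauge v = 1 by apply/gauge_eq1; rewrite -xE.
have v0 : v != 0.
  apply/eqP => e; have : gauge v < 1.
    apply/gauge_lt1; rewrite e addr0; apply/interior_enormP; exists r => // y yo.
    exact/ball_o/ltW.
  by rewrite g1 ltxx.
have p0 : 0 < 2 * pi :> R by rewrite mulr_gt0// pi_gt0.
have [t /andP[t0 t1] ct] := circle_point_surj (S1_unit v0).
exists (t / (2 * pi)).
  by rewrite /= in_itv /= divr_ge0 ?(ltW p0)//= ler_pdivrMr// mul1r ltW.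
rewrite /radial mulrC divfK ?gt_eqF// ct gaugeZ ?invr_gt0 ?enorm_gt0// g1 mulr1.
by rewrite invrK scalerA mulfV ?gt_eqF ?enorm_gt0// scale1r -xE.
Qed.

Lemma radial_inj : {in `[0, 1[ &, injective radial}.
Proof.
move=> s t; rewrite !in_itv /= => /andP[s0 s1] /andP[t0 t1] /addrI e.
have p0 : 0 < 2 * pi :> R by rewrite mulr_gt0// pi_gt0.
have normE z : enorm ((gauge (circle_point z))^-1 *: circle_point z) =
    (gauge (circle_point z))^-1.
  rewrite enormZ (S1_circle_point z) mulr1 gtr0_norm// invr_gt0.
  exact: gauge_circle_gt0.
have := congr1 (@enorm R) e; rewrite !normE => eg; rewrite eg in e.
have gn0 : (gauge (circle_point (2 * pi * t)))^-1 != 0.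
  by rewrite invr_eq0 gt_eqF.
have ec := scalerI gn0 e.
apply: (mulfI (lt0r_neq0 p0)); apply: circle_point_inj ec.
- by rewrite mulr_ge0// ltW.
- by rewrite gtr_pMr.
- by rewrite mulr_ge0// ltW.
- by rewrite gtr_pMr.
Qed.

Lemma radial_closed : radial 0 = radial 1.
Proof. by rewrite /radial mulr1 mulr0 circle_point_2pi. Qed.

(** Every point of [K] lies between the two boundary points of a line through
    [o]. *)
Lemma hull_boundary_gauge : K `<=` convex_hull (boundary K).
Proof.
move=> x Kx.
have [s [u [s0 Su xE]]] : exists s u, [/\ 0 <= s, S1 u & x = o + s *: u].
  have [xo|xo] := eqVneq (x - o) 0.
    have [u Su] := S1_nonempty R; exists 0, u; split => //.
    by rewrite scale0r addr0; exact/subr0_eq.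
  exists (enorm (x - o)), ((enorm (x - o))^-1 *: (x - o)); split.
  - exact: enorm_ge0.
  - exact: S1_unit.
  - by rewrite scalerA mulfV ?gt_eqF ?enorm_gt0// scale1r addrC subrK.
have u0 : u != 0.
  by apply/eqP => e; move: Su; rewrite /S1 /= e enorm0 => /esym/eqP; rewrite oner_eq0.
have a0 := gauge_gt0 u0.
have b0 : 0 < gauge (- u) by apply: gauge_gt0; rewrite oppr_eq0.
set a := gauge u in a0 *; set b := gauge (- u) in b0 *.
have Ba : boundary K (o + a^-1 *: u).
  by apply/gauge_eq1; rewrite gaugeZ ?invr_gt0// mulVf// gt_eqF.
have Bb : boundary K (o + b^-1 *: - u).
  by apply/gauge_eq1; rewrite gaugeZ ?invr_gt0// mulVf// gt_eqF.
have sa : s * a <= 1.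
  have [->|sn0] := eqVneq s 0; first by rewrite mul0r.
  rewrite -gaugeZ; last by rewrite lt_neqAle eq_sym sn0.
  by apply/gauge_le1; rewrite -xE.
have ab0 : 0 < a + b by rewrite addr_gt0.
(* the solution of [l / a - (1 - l) / b = s] *)
set l := a * (1 + s * b) / (a + b).
have l0 : 0 <= l.
  by rewrite divr_ge0 ?(ltW ab0)// mulr_ge0 ?(ltW a0)// addr_ge0// mulr_ge0// ltW.
have l1 : l <= 1.
  rewrite ler_pdivrMr// mul1r mulrDr mulr1 lerD2l mulrCA mulrA mulrC.
  by rewrite ler_piMr// ltW.
have sB := @sub_smallest _ (@convex_set R plane) _ _ (@subset_refl _ (boundary K)).
have -> : x = l *: (o + a^-1 *: u) + (1 - l) *: (o + b^-1 *: - u).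
  rewrite xE /l; apply: plane_eqP; rewrite !mxE; field; rewrite !gt_eqF//.
apply: ((convexP _).1 (@convex_convex_hull R 2 (boundary K))) => //; exact: sB.
Qed.

End Gauge.

(** * Escape paths around convex sets *)

Section Traversal.
Variable R : realType.
Local Notation plane := ('rV[R]_2).
Implicit Types (x y u v w p q : plane) (A F K : set plane).

Definition det2 v w : R := v ord0 ord0 * w ord0 ord_max - v ord0 ord_max * w ord0 ord0.

(** The quarter turn that makes [det2] a scalar product. *)
Definition rot v : plane :=
  \row_j (if j == ord0 then v ord0 ord_max else - v ord0 ord0).

Lemma det2E v w : det2 v w = dot v (rot w).
Proof. by rewrite dotE !mxE /= /det2; ring. Qed.

Lemma det2_continuous w p : continuous (fun y => det2 (y - p) w).
Proof.
apply: (@lipschitz_continuous _ _ (enorm (rot w))) => x y.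
rewrite !det2E -dotBl opprB addrA subrK mulrC; exact: dot_le_enorm.
Qed.

(** Points whose barycentric coordinates in a nondegenerate triangle are all
    positive form a neighborhood of the centroid. *)
Lemma triangle_interior K p a b : @convex_set R plane K -> K p -> K a -> K b ->
  det2 (a - p) (b - p) != 0 -> K° !=set0.
Proof.
move=> /convexP vK Kp Ka Kb; set D := det2 _ _ => D0.
(* barycentric coordinates with respect to [a] and [b], by Cramer's rule *)
pose al y := det2 (y - p) (D^-1 *: (b - p)).
pose be y := det2 (y - p) (- D^-1 *: (a - p)).
pose c := p + 3^-1 *: (a - p) + 3^-1 *: (b - p).
have ca : al c = 3^-1.
  rewrite /al /c /D /det2 !mxE; field; move: D0; rewrite /D /det2 !mxE//.
have cb : be c = 3^-1.
  rewrite /be /c /D /det2 !mxE; field; move: D0; rewrite /D /det2 !mxE//.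
exists c; rewrite /interior /=; near=> y.
have ya : 0 < al y.
  by near: y; apply: (cvgr_gt (al c)); [exact: det2_continuous|rewrite ca invr_gt0].
have yb : 0 < be y.
  by near: y; apply: (cvgr_gt (be c)); [exact: det2_continuous|rewrite cb invr_gt0].
(* upper bounds between 1/3, the value at the centroid, and 1/2 keep the third
   coordinate positive *)
have ya2 : al y < 2^-1.
  near: y; apply: (cvgr_lt (al c)); first exact: det2_continuous.
  by rewrite ca ltf_pV2// ?posrE// ltr_nat.
have yb2 : be y < 2^-1.
  near: y; apply: (cvgr_lt (be c)); first exact: det2_continuous.
  by rewrite cb ltf_pV2// ?posrE// ltr_nat.
have b1 : 0 < 1 - be y by lra.
have -> : y = be y *: b + (1 - be y) *:
    ((al y / (1 - be y)) *: a + (1 - al y / (1 - be y)) *: p).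
  have -> : be y *: b + (1 - be y) *:
    ((al y / (1 - be y)) *: a + (1 - al y / (1 - be y)) *: p) =
    p + al y *: (a - p) + be y *: (b - p).
    by apply: plane_eqP; rewrite !mxE; field; rewrite gt_eqF.
  apply: plane_eqP; rewrite /al /be /D /det2 !mxE; field;
    move: D0; rewrite /D /det2 !mxE//.
apply: (vK) => //; [|exact: ltW|lra].
apply: vK => //; first by rewrite divr_ge0 ?ltW.
rewrite ler_pdivrMr//; lra.
Unshelve. all: by end_near. Qed.

(** Without interior points all points of [K] are collinear; the endpoints are
    those that maximize and minimize a linear form along the line. *)
Lemma thin_segment K x : K2 K -> ~ (K° !=set0) -> K x -> K != [set x] ->
  exists p q, p <> q /\ K = segment p q.
Proof.
move=> [K0 cK vK] thin Kx Kneq.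
have [y Ky yx] : exists2 y, K y & y - x != 0.
  apply: contrapT => /forall2NP h; move/eqP: Kneq; apply; apply/seteqP; split.
    move=> y Ky; have [//|/negP] := h y; rewrite negbK subr_eq0 => /eqP //.
  by move=> _ ->.
set d := y - x in yx.
have d2 : 0 < dot d d by rewrite -sqr_enorm exprn_gt0// enorm_gt0.
have lineE z : K z -> z = x + (dot (z - x) d / dot d d) *: d.
  move=> Kz; have [D0|D0] := eqVneq (det2 (y - x) (z - x)) 0; last first.
    by case: thin; exact: triangle_interior D0.
  have D2 : dot d d != 0 by rewrite gt_eqF.
  move: D0; rewrite -/d; set e := z - x => D0.
  rewrite -(subrK x z) -/e addrC; congr (_ + _); apply: (scalerI D2).
  rewrite scalerA mulrC divfK//; move: D0; rewrite /det2 => D0.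
  apply: plane_eqP; rewrite [LHS]mxE [RHS]mxE !dotE.
    have : d ord0 ord_max * (d ord0 ord0 * e ord0 ord_max - d ord0 ord_max * e ord0 ord0) = 0.
      by rewrite D0 mulr0.
    by move=> /eqP; rewrite -subr_eq0 => /eqP ?; lra.
  have : d ord0 ord0 * (d ord0 ord0 * e ord0 ord_max - d ord0 ord_max * e ord0 ord0) = 0.
    by rewrite D0 mulr0.
  by move=> ?; lra.
(* [co] is the coordinate along the line that carries [K] *)
pose co z := dot (z - x) d / dot d d.
have [q Kq qm] := support_attained d cK K0.
have [p Kp pm] := support_attained (- d) cK K0.
have coq z : K z -> co z <= co q.
  move=> Kz; rewrite /co ler_pM2r ?invr_gt0// !dotBl lerD2r -qm.
  exact: support_ge.
have cop z : K z -> co p <= co z.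
  move=> Kz; rewrite /co ler_pM2r ?invr_gt0// !dotBl lerD2r.
  by rewrite -lerN2 -!dotNr -pm; exact: support_ge.
have cox : co x = 0 by rewrite /co subrr dot0l mul0r.
have coy : co y = 1 by rewrite /co mulfV// gt_eqF.
have pq : 0 < co q - co p.
  have := coq _ Ky; have := cop _ Kx; rewrite cox coy; lra.
exists p, q; split.
  by move=> e; rewrite e subrr ltxx in pq.
apply/seteqP; split=> z.
  move=> Kz; exists ((co z - co p) / (co q - co p)).
    rewrite /= in_itv /= divr_ge0 ?(ltW pq) ?subr_ge0 ?cop//=.
    by rewrite ler_pdivrMr// mul1r lerD2r coq.
  have pE : p = x + co p *: d := lineE _ Kp.
  have qE : q = x + co q *: d := lineE _ Kq.
  have -> : q - p = (co q - co p) *: d.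
    by rewrite [in LHS]qE [in LHS]pE opprD addrACA subrr add0r scalerBl.
  rewrite scalerA divfK ?gt_eqF// [RHS](lineE _ Kz) {1}pE -addrA -scalerDl.
  by congr (_ + _ *: _); rewrite addrC subrK.
move=> [t]; rewrite /= in_itv /= => /andP[t0 t1] <-.
have -> : p + t *: (q - p) = t *: q + (1 - t) *: p.
  by apply: plane_eqP; rewrite !mxE; ring.
by move/convexP : vK; apply.
Qed.

Lemma interior_convex F : @convex_set R plane F -> @convex_set R plane F°.
Proof.
move=> /convexP vF; apply/convexP => x y t /interior_enormP[e e0 xe]
  /interior_enormP[e' e'0 ye] t0 t1.
apply/interior_enormP; exists (Num.min e e'); first by rewrite lt_min e0.
move=> z; set w := z - _; rewrite lt_min => /andP[we we'].
have -> : z = t *: (x + w) + (1 - t) *: (y + w).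
  by rewrite /w; apply: plane_eqP; rewrite !mxE; ring.
by apply: vF => //; [apply: xe|apply: ye]; rewrite addrC addKr.
Qed.

(** The interior of [F] being convex, a copy of [A] fits in it only with its
    convex hull. *)
Lemma unfit_hull F A : @convex_set R plane F -> unfit F (convex_hull A) -> unfit F A.
Proof.
move=> vF uH a Q OQ sub; apply: (uH a Q OQ) => _ [x Hx <-].
have cv : @convex_set R plane [set x | F° (a + mxact Q x)].
  apply/convexP => y z t Fy Fz t0 t1 /=.
  have -> : a + mxact Q (t *: y + (1 - t) *: z) =
      t *: (a + mxact Q y) + (1 - t) *: (a + mxact Q z).
    rewrite mxactD !mxactZ !scalerDr addrACA -scalerDl.
    by rewrite [in RHS](addrC t) subrK scale1r.
  by move/convexP: (interior_convex vF); apply.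
have h : convex_hull A `<=` [set x | F° (a + mxact Q x)].
  by apply: smallest_sub => // y Ay; apply: sub; exists y.
exact: h.
Qed.

Lemma hull_boundary K : compact K -> @convex_set R plane K -> K° !=set0 ->
  convex_hull (boundary K) = K.
Proof.
move=> cK vK [c /interior_enormP[e e0 eK]]; apply/seteqP; split.
  apply: smallest_sub => // x; rewrite closed_boundaryE; last exact: compactK_closed.
  by case.
apply: (@hull_boundary_gauge R K c (e / 2)) => //; first by rewrite divr_gt0.
by move=> x xo; apply: eK; lra.
Qed.

Lemma boundary_path K : compact K -> @convex_set R plane K -> K° !=set0 ->
  exists g, [/\ closed_path g, {in `[0, 1[ &, injective g} & trace g = boundary K].
Proof.
move=> cK vK [c /interior_enormP[e e0 eK]].
have r0 : 0 < e / 2 by rewrite divr_gt0.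
have ball_o x : enorm (x - c) <= e / 2 -> K x by move=> xo; apply: eK; lra.
exists (radial K c); split; last exact: radial_trace ball_o.
  split; last exact: radial_closed.
  exact/continuous_subspaceT/(radial_continuous cK r0 ball_o).
exact: radial_inj ball_o.
Qed.

(** The parameter [1 - |2 * t - 1|] rises from 0 to 1 and falls back. *)
Lemma segment_path p q (g := fun t : R => p + (1 - `|2 * t - 1|) *: (q - p)) :
  closed_path g /\ trace g = segment p q.
Proof.
split; first split.
- apply: continuous_subspaceT => t; apply: cvgD; first exact: cvg_cst.
  apply: cvgZr_tmp; apply: cvgB; first exact: cvg_cst.
  apply: cvg_norm; apply: cvgB; last exact: cvg_cst.
  exact: mulrl_continuous.
- by rewrite /g mulr0 mulr1 sub0r normrN normr1 (_ : 2 - 1 = 1) ?normr1//; ring.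
apply/seteqP; split => x.
  move=> [t]; rewrite /= in_itv /= => /andP[t0 t1] <-.
  exists (1 - `|2 * t - 1|) => //; rewrite /= in_itv /= subr_ge0 lerBlDr lerDl.
  by rewrite normr_ge0 andbT ler_norml; apply/andP; split; lra.
move=> [s]; rewrite /= in_itv /= => /andP[s0 s1] <-.
exists (s / 2); first by rewrite /= in_itv /=; apply/andP; split; lra.
rewrite /g mulrC divfK// distrC ger0_norm ?subr_ge0//.
by rewrite (_ : 1 - (1 - s) = s)//; ring.
Qed.

(** Traversing the boundary loses neither unfitness nor diameter, because the
    hull of the boundary is [K]. A single point always fits. *)
Lemma feasibleB_traversal F K : convex_body F -> feasibleB F K ->
  exists g, [/\ boundary_traversal K g, escape_path F g & diam (trace g) = diam K].
Proof.
move=> Fb [K2K uK]; have [K0 cK vK] := K2K; have [_ vF [f Ff]] := Fb.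
have [K_int|thin] := pselect (K° !=set0).
  have [g [cg ig tg]] := boundary_path cK vK K_int.
  exists g; split.
  - by left.
  - by split => //; apply: unfit_hull => //; rewrite tg hull_boundary.
  - rewrite -[in RHS](hull_boundary cK vK K_int) -tg diam_convex_hull//.
      exact: trace_nonempty.
    by apply: compact_trace; case: cg.
have [x Kx] := K0.
have Kneq : K != [set x].
  apply/eqP => Ke; apply: (uK (f - x) 1%:M (O2_id _)) => _ [y Ky <-].
  by rewrite mxact_id; move: Ky; rewrite Ke => ->; rewrite subrK.
have [p [q [pq Ke]]] := thin_segment K2K thin Kx Kneq.
have [cg tg] := segment_path p q.
exists (fun t : R => p + (1 - `|2 * t - 1|) *: (q - p)); split.
- by right; exists p, q.
- by split => //; rewrite tg -Ke.
- by rewrite tg -Ke.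
Qed.

End Traversal.

(** * The Steiner point *)

Section Steiner.
Variable R : realType.
Local Notation plane := ('rV[R]_2).
Implicit Types (K : set plane) (v : plane) (f g : R -> R).

Lemma integral_primitive f g (a b : R) : a < b -> continuous f ->
  (forall t : R, is_derive t 1 g (f t)) ->
  \int[lebesgue_measure]_(t in `[a, b]) f t = g b - g a.
Proof.
move=> ab cf dg.
have cg : continuous g.
  by move=> t; apply: differentiable_continuous; apply/derivable1_diffP; case: (dg t).
rewrite /Rintegral (@continuous_FTC2 _ f g)//.
- exact: continuous_subspaceT.
- split; first by move=> t _; case: (dg t).
    by apply: cvg_at_right_filter; exact: cg.
  by apply: cvg_at_left_filter; exact: cg.
- by move=> t _; rewrite derive1E; case: (dg t).
Qed.

Lemma continuous_integrable f (a b : R) : continuous f ->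
  lebesgue_measure.-integrable `[a, b] (EFin \o f).
Proof.
move=> cf; apply: continuous_compact_integrable; first exact: segment_compact.
exact: continuous_subspaceT.
Qed.

Let circle_moment_continuous v j :
  continuous (fun t : R => dot v (circle_point t) * circle_point t ord0 j).
Proof.
under eq_fun do rewrite dotC.
apply: (@continuous_circle R (fun x => dot x v * x ord0 j)) => x.
exact: (cvgM (@dot_continuous R v x) (@coord_continuous _ _ _ _ _ x)).
Qed.

(** The second moments of the circle: its inertia is isotropic, [cos ^+ 2] and
    [sin ^+ 2] having the same integral and [cos * sin] integrating to zero. *)
Lemma circle_moment v j :
  \int[lebesgue_measure]_(theta in `[0, 2 * pi])
    (dot v (circle_point theta) * circle_point theta ord0 j) = pi * v ord0 j.
Proof.
have p0 : 0 < 2 * pi :> R by rewrite mulr_gt0// pi_gt0.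
have [s2 c2] : sin (2 * pi) = 0 :> R /\ cos (2 * pi) = 1 :> R.
  by rewrite mulr_natl sin2pi cos2pi.
have [->|->] : j = ord0 \/ j = ord_max.
- by case: j => [[|[|//]] h]; [left|right]; apply: val_inj.
- pose g (t : R) := v ord0 ord0 * ((t + sin t * cos t) / 2) + v ord0 ord_max * (sin t ^+ 2 / 2).
  have dg (t : R) : is_derive t 1 g (dot v (circle_point t) * circle_point t ord0 ord0).
    apply: is_derive_eq; rewrite dotE circle_point0 circle_point1 /=.
    have : v ord0 ord0 * (cos t ^+ 2 + sin t ^+ 2) = v ord0 ord0.
      by rewrite cos2Dsin2 mulr1.
    by rewrite /GRing.scale /=; lra.
  rewrite (integral_primitive p0 (@circle_moment_continuous v ord0) dg) /g s2 c2 sin0 cos0.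
  by field.
pose g (t : R) := v ord0 ord0 * (sin t ^+ 2 / 2) + v ord0 ord_max * ((t - sin t * cos t) / 2).
have dg (t : R) : is_derive t 1 g (dot v (circle_point t) * circle_point t ord0 ord_max).
  apply: is_derive_eq; rewrite dotE circle_point0 circle_point1 /=.
  have : v ord0 ord_max * (cos t ^+ 2 + sin t ^+ 2) = v ord0 ord_max.
    by rewrite cos2Dsin2 mulr1.
  by rewrite /GRing.scale /=; lra.
rewrite (integral_primitive p0 (@circle_moment_continuous v ord_max) dg) /g s2 c2 sin0 cos0.
by field.
Qed.

(** A translation by [v] adds [dot v u] to the support function, which contributes
    [v] by the isotropy of the circle. *)
Lemma steiner_translate K v : compact K -> K !=set0 ->
  steiner [set x + v | x in K] = steiner K + v.
Proof.
move=> cK K0; apply/rowP => j; rewrite !mxE.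
under eq_Rintegral do rewrite support_translate// mulrDl.
rewrite RintegralD//=.
- rewrite mulrDr circle_moment mulKf// gt_eqF//; exact: pi_gt0.
- apply: continuous_integrable.
  apply: (@continuous_circle R (fun x => support_fun K x * x ord0 j)) => x.
  exact: (cvgM (support_continuous cK K0 (x := x)) (@coord_continuous _ _ _ _ _ x)).
- exact/continuous_integrable/circle_moment_continuous.
Qed.

End Steiner.

(** * Equivalence of the three problems *)

Section Equivalence.
Variable R : realType.
Local Notation plane := ('rV[R]_2).
Implicit Types (K F : set plane) (g : R -> plane).

Lemma escape_hull_feasibleB F g : escape_path F g ->
  feasibleB F (convex_hull (trace g)) /\ diam (convex_hull (trace g)) = diam (trace g).
Proof.
move=> [[cg _] ug]; have ct := compact_trace cg; have t0 := trace_nonempty g.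
split; last exact: diam_convex_hull.
have sH : trace g `<=` convex_hull (trace g) by exact: sub_smallest.
split; last exact: unfit_sub sH ug.
split; [by case: t0 => x /sH; exists x|exact: compact_hull|].
exact: convex_convex_hull.
Qed.

(** Hulls of escape paths are feasible sets of the same diameter, and feasible
    sets have boundary paths of the same diameter: the infimum over paths and the
    minimum over sets agree. *)
Lemma critical_diamP F : convex_body F ->
  (exists2 L, feasibleB F L & diam L = critical_diam F) /\
  (forall K, feasibleB F K -> critical_diam F <= diam K).
Proof.
move=> Fb; have [L Lf Lm] := exists_minB Fb.
have lb : lbound [set diam (trace g) | g in escape_path F] (diam L).
  move=> _ [g /escape_hull_feasibleB[Hf Hd] <-]; rewrite -Hd; exact: Lm.
have le K : feasibleB F K -> critical_diam F <= diam K.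
  move=> Kf; have [g [_ eg <-]] := feasibleB_traversal Fb Kf.
  by apply: ge_inf; [exists (diam L)|exists g].
split => //; exists L => //; apply/eqP; rewrite eq_le le// andbT.
have [g [_ eg _]] := feasibleB_traversal Fb Lf.
by apply: lb_le_inf => //; exists (diam (trace g)), g.
Qed.

Lemma feasibleC_supportP F K : convex_body F -> K2 K -> steiner K = 0 ->
  feasibleB F K <-> feasibleC F (support_fun K).
Proof.
move=> Fb K2K sK; have [cF vF _] := Fb; have F0 := body_nonempty Fb.
have [K0 cK vK] := K2K; split => [[_ uK]|[_ PsiK]].
  split; first by exists K.
  by move=> Q OQ; apply/(Psi_ge0P F0 cF vF K0 cK OQ) => a; exact: uK.
by split => // a Q OQ; apply: (Psi_ge0P F0 cF vF K0 cK OQ).1; exact: PsiK.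
Qed.

Lemma feasibleB_steiner F K : feasibleB F K ->
  let K0 := [set x - steiner K | x in K] in
  [/\ steiner K0 = 0, feasibleB F K0 & diam K0 = diam K].
Proof.
move=> Kf; have [[K_0 cK _] _] := Kf; split.
- by rewrite steiner_translate// subrr.
- exact: feasibleB_translate.
- exact: diam_translate.
Qed.

End Equivalence.

Theorem theorem6 (R : realType) (F : set 'rV[R]_2) (Fbody : convex_body F) :
  (* the minimum over a defining Psi is attained *)
  (forall (h : 'rV[R]_2 -> R) (Q : 'M[R]_2), H0 h -> O2 Q ->
     is_min (range (excess F h Q)) (Psi F h Q)) /\
  (* (A), (B), (C) *)
  is_min [set objectiveA g | g in feasibleA F] (critical_diam F) /\
  is_min [set diam K | K in feasibleB F] (critical_diam F) /\
  is_min [set objectiveC h | h in feasibleC F] (critical_diam F) /\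
  (* convexification, from (A) to (B) *)
  (forall g : R -> 'rV[R]_2, feasibleA F g ->
     feasibleB F (convex_hull (trace g)) /\
     diam (convex_hull (trace g)) = diam (trace g)) /\
  (* Steiner-point normalization in (B) *)
  (forall K : set 'rV[R]_2, feasibleB F K ->
     let K0 := [set x - steiner K | x in K] in
     [/\ steiner K0 = 0, feasibleB F K0 & diam K0 = diam K]) /\
  (* normalized sets in (B) correspond to their support functions in (C) *)
  (forall K : set 'rV[R]_2, K2 K -> steiner K = 0 ->
     (feasibleB F K <-> feasibleC F (support_fun K)) /\
     objectiveC (support_fun K) = diam K) /\
  (* optimal sets in (B) generate optimal closed escape paths *)
  (forall K : set 'rV[R]_2, feasibleB F K -> diam K = critical_diam F ->
     exists g : R -> 'rV[R]_2,
       [/\ boundary_traversal K g, escape_path F g & diam (trace g) = critical_diam F]).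
Proof.
have [cF vF _] := Fbody; have F0 := body_nonempty Fbody.
have [[L Lf Ld] lbB] := critical_diamP Fbody.
split.
  move=> _ Q [K [[K0 cK _] _] <-] OQ; exact: Psi_attained.
split.
  have [g [_ eg gd]] := feasibleB_traversal Fbody Lf.
  split.
    exists (fun t => g t - g 0); first exact: escape_feasibleA.
    by rewrite objectiveAE trace_translate diam_translate gd.
  move=> _ [f /(feasibleA_escape Fbody) /escape_hull_feasibleB[Hf Hd] <-].
  by rewrite objectiveAE -Hd; exact: lbB.
split.
  by split; [exists L|move=> _ [K Kf <-]; exact: lbB].
split.
  have [sL0 L0f L0d] := feasibleB_steiner Lf; set L0 := image _ _ in sL0 L0f L0d.
  have [L02 _] := L0f; have [L0_0 cL0 _] := L02; split.
    exists (support_fun L0); first exact/feasibleC_supportP.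
    by rewrite objectiveC_support// L0d.
  move=> _ [h hf <-]; have [[K [K2K sK] hE] _] := hf; rewrite -hE in hf *.
  have [K0 cK _] := K2K; rewrite objectiveC_support//; apply: lbB.
  exact/feasibleC_supportP.
split.
  by move=> g /(feasibleA_escape Fbody); exact: escape_hull_feasibleB.
split; first by move=> K; exact: feasibleB_steiner.
split.
  move=> K K2K sK; split; first exact: feasibleC_supportP.
  by have [K0 cK _] := K2K; exact: objectiveC_support.
move=> K Kf Kd; have [g [tg eg gd]] := feasibleB_traversal Fbody Kf.
by exists g; split => //; rewrite gd.
Qed.
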